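(* Let $(\widehat{\mathbf x},\widehat{\mathbf u})$ be an optimal pair for the control problem described in the context, and assume that (A1)–(A4) hold. Assume moreover that, almost surely, $\varphi$ satisfies a Lipschitz condition in a neighborhood of the point $(\widehat x(t_{N+1}),\mathbf E\widehat x(t_{N+1}))$ and is differentiable at that point. Then there exists a solution $(p,q^1,\dots,q^d)$, with $p(t)$ ($t\in\mathbb T\cup\{t_{N+1}\}$) and $q^j(t)$ ($t\in\mathbb T$) being $\mathbb R^n$-valued and $\mathfrak F_t$-measurable, of the discrete-time backward stochastic equation $$ \begin{cases} p(t)=\bigl(I+h\widehat f_x^{\intercal}[t]\bigr)\mathbf E\{p(t+h)\mid\mathfrak F_t\}+h\,\mathbf E\{\widehat f_y^{\intercal}[t]\,p(t+h)\}\\ \qquad\quad+\sum_{j=1}^d(\widehat\sigma_x^j[t])^{\intercal}q^j(t)+\sum_{j=1}^d\mathbf E\{(\widehat\sigma_y^j[t])^{\intercal}q^j(t)\}-\widehat l_x[t]-\mathbf E\widehat l_y[t],\quad t\in\mathbb T,\\ p(t_{N+1})=-\varphi_x\bigl(\widehat x(t_{N+1}),\mathbf E\widehat x(t_{N+1})\bigr)-\mathbf E\varphi_y\bigl(\widehat x(t_{N+1}),\mathbf E\widehat x(t_{N+1})\bigr),\\ q^j(t)=\mathbf E\{p(t+h)w_h^j(t)\mid\mathfrak F_t\},\quad t\in\mathbb T,\ j=1,\dots,d, \end{cases} $$ such that for every $t\in\mathbb T$ and every $v\in\mathcal U(t)$, $$\bigl\langle H_u(t,\widehat u(t)),\,v-\widehat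 u(t)\bigr\rangle\le 0\quad\text{a.s.},$$ where $$H(t,v)=\bigl\langle\mathbf E\{p(t+h)\mid\mathfrak F_t\},\,hf(t,\widehat x(t),\mathbf E\widehat x(t),v)\bigr\rangle+\sum_{j=1}^d\bigl\langle q^j(t),\sigma^j(t,\widehat x(t),\mathbf E\widehat x(t),v)\bigr\rangle-l(t,\widehat x(t),\mathbf E\widehat x(t),v)$$ and $H_u(t,\cdot)$ denotes the gradient of $H(t,\cdot)$ with respect to the control variable $v$.
   Context: Probabilistic setting. $(\Omega,\mathfrak F,\mathbb P)$ is a complete probability space, $N$ a positive integer, $h>0$, $t_k=t_0+kh$, $\mathbb T=\{t_0,\dots,t_N\}$, $t_{N+1}=t_N+h$. $(w(t_k))_{k=1}^{N+1}$ are $\mathbb R^d$-valued random variables, $w(t_0)=0$, $\mathfrak F_{t_k}=\mathfrak F_k=\sigma\{w(t_1),\dots,w(t_k)\}$ for $k\ge1$, $\mathfrak F_{t_0}=\mathfrak F_0=\{\emptyset,\Omega\}$. The increments $w_h(t_k)=w(t_{k+1})-w(t_k)=(w_h^1(t_k),\dots,w_h^d(t_k))$ satisfy: for each $k$, $w_h^1(t_k),\dots,w_h^d(t_k)$ are independent real random variables; $\mathbf E\{w_h(t_k)\mid\mathfrak F_k\}=0$; $\mathbf E\{(w_h^j(t_k))^2\mid\mathfrak F_k\}=h$; $\mathbf E(w_h^j(t_k))^4<\infty$; $\mathbf E(w_h^m(t_k)w_h^l(t_k))=h\,\delta_{ml}$. Moreover $\mathfrak F_k$ is independent of $\sigma\{w_h(t_{k+1}),\dots,w_h(t_N)\}$.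 $L^2(\Omega,\mathfrak F_t,\mathbb R^m)$ is the set of square-integrable $\mathfrak F_t$-measurable $\mathbb R^m$-valued random variables. $A^{\intercal}$ denotes transpose. Control problem. $\varphi:\mathbb R^n\times\mathbb R^n\to\mathbb R$, $l:\mathbb T\times\mathbb R^n\times\mathbb R^n\times\mathbb R^r\to\mathbb R$, $f,\sigma^j:\mathbb T\times\mathbb R^n\times\mathbb R^n\times\mathbb R^r\to\mathbb R^n$ ($j=1,\dots,d$); arguments are written $(t,x,y,u)$ (for $\varphi$: $(x,y)$), and subscripts $x,y,u$ denote partial derivatives. $\mathcal U(t)$, $t\in\mathbb T$, are nonempty convex subsets of $\mathbb R^r$, and $\mathfrak U_{ad}$ is the set of all $u=\{u(t)\}_{t\in\mathbb T}$ with $u(t)\in L^2(\Omega,\mathfrak F_t,\mathbb R^r)$ and $u(t)\in\mathcal U(t)$. For $u\in\mathfrak U_{ad}$ the state is given by $$x(t+h)=x(t)+hf(t,x(t),\mathbf Ex(t),u(t))+\sum_{j=1}^d\sigma^j(t,x(t),\mathbf Ex(t),u(t))\,w_h^j(t),\quad t\in\mathbb T,\qquad x(t_0)=\xi\in\mathbb R^n,$$ and the cost, to be minimized over $\mathfrak U_{ad}$, is $$J(u)=\mathbf E\varphi(x(t_{N+1}),\mathbf Ex(t_{N+1}))+\mathbf E\sum_{t=t_0}^{t_N}l(t,x(t),\mathbf Ex(t),u(t)).$$ (Sums over $t$ run over $t_0,t_1,\dots,t_N$.) An optimal pair $(\widehat{\mathbf x},\widehat{\mathbf u})$ consists of a minimizer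 $\widehat u\in\mathfrak U_{ad}$ and its state $\widehat x$. For $\psi\in\{f,\sigma^j,l\}$ write $\widehat\psi[t]=\psi(t,\widehat x(t),\mathbf E\widehat x(t),\widehat u(t))$, and similarly $\widehat\psi_x[t],\widehat\psi_y[t],\widehat\psi_u[t]$ for the partial derivatives at that point. Assumptions, where $\psi$ stands for each of $l,f,\sigma^j,\varphi$ (for $\varphi$ the arguments $t,u$ are absent): (A1) There is $L>0$ with $\|\psi(t,x_1,y_1,u_1)-\psi(t,x_2,y_2,u_2)\|\le L(\|x_1-x_2\|+\|y_1-y_2\|+\|u_1-u_2\|)$ and $\|\psi(t,0,0,0)\|\le L$ for all $t\in\mathbb T$, $x_i,y_i\in\mathbb R^n$, $u_i\in\mathbb R^r$. (A2) $\psi$ is continuously differentiable with respect to $(x,y,u)$, and there is $L_1>0$ with $\|\psi_x(t,x_1,y_1,u_1)-\psi_x(t,x_2,y_2,u_2)\|\le L_1(\|x_1-x_2\|+\|y_1-y_2\|+\|u_1-u_2\|)$ and $\|\psi_x(t,0,0,0)\|\le L_1$ for all such arguments. (A3) $\mathcal U(t)$ is convex for each $t\in\mathbb T$. (A4) For each $t\in\mathbb T$ the set $\{(f,\sigma^1,\dots,\sigma^d,l)(t,\widehat x(t),\mathbf E\widehat x(t),v):v\in\mathcal U(t)\}$ is convex. *)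

(* Defs.v *)
From HB Require Import structures.
From mathcomp Require Import all_boot all_order all_algebra.
From mathcomp Require Import all_classical all_reals all_analysis.

Set Implicit Arguments.
Unset Strict Implicit.
Unset Printing Implicit Defensive.

Import Order.TTheory GRing.Theory Num.Theory.
Import numFieldNormedType.Exports.

Local Open Scope classical_set_scope.
Local Open Scope ring_scope.

(* Vectors of R^n are columns, and `|.| is the library norm (max of the
   entries); it only occurs in estimates whose constant is existentially
   quantified, so that replacing it by the Euclidean norm changes nothing. *)

Definition dot (R : realType) (n : nat) (a b : 'cV[R]_n) : R :=
  \sum_(i < n) a i ord0 * b i ord0.

Definition gradient (R : realType) (n : nat) (g : 'cV[R]_n -> R)
    (x : 'cV[R]_n) : 'cV[R]_n :=
  \col_j 'D_(delta_mx j ord0) (g : 'cV[R]_n -> R^o) x.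

(* Row i, column j: partial derivative of the i-th component along x_j. *)
Definition jacobian_mx (R : realType) (n p : nat)
    (g : 'cV[R]_n -> 'cV[R]_p) (x : 'cV[R]_n) : 'M[R]_(p, n) :=
  \matrix_(i, j)
    'D_(delta_mx j ord0) ((fun z => g z i ord0) : 'cV[R]_n -> R^o) x.

Section Probability.
Context {disp : measure_display} {Omega : measurableType disp} {R : realType}.
Variable P : probability Omega R.
Implicit Types F G : set (set Omega).

Definition measurable_wrt F (X : Omega -> R) : Prop :=
  forall B : set R, measurable B -> F (X @^-1` B).

Definition measurable_vec_wrt (n : nat) F (X : Omega -> 'cV[R]_n) : Prop :=
  forall i, measurable_wrt F (fun w => X w i ord0).

Definition integrable_rv (X : Omega -> R) : Prop :=
  P.-integrable setT (EFin \o X).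

Definition integrable_vec (n : nat) (X : Omega -> 'cV[R]_n) : Prop :=
  forall i, integrable_rv (fun w => X w i ord0).

Definition L2_vec (n : nat) F (X : Omega -> 'cV[R]_n) : Prop :=
  measurable_vec_wrt F X /\
  forall i, (fun w => X w i ord0) \in Lfun P 2%:E.

Definition expect_vec (n : nat) (X : Omega -> 'cV[R]_n) : 'cV[R]_n :=
  \col_i fine ('E_P[fun w => X w i ord0])%E.

(* Y is a version of E{X | F}; F is a sub-sigma-algebra of the measurable
   sets. *)
Definition is_cond_expect F (X Y : Omega -> R) : Prop :=
  [/\ integrable_rv X, integrable_rv Y, measurable_wrt F Y &
      forall A, F A ->
        (\int[P]_(w in A) (Y w)%:E = \int[P]_(w in A) (X w)%:E)%E].

(* A chosen version of E{X | F}; it is 0, without meaning, when X is not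
   integrable. *)
Definition cond_expect F (X : Omega -> R) : Omega -> R :=
  xget (cst 0) [set Y | is_cond_expect F X Y].

Definition cond_expect_vec (n : nat) F (X : Omega -> 'cV[R]_n)
    (w : Omega) : 'cV[R]_n :=
  \col_i cond_expect F (fun w' => X w' i ord0) w.

Definition independent_rv (m : nat) (X : 'I_m -> Omega -> R) : Prop :=
  forall (J : {set 'I_m}) (B : 'I_m -> set R), (forall j, measurable (B j)) ->
    P (\bigcap_(j in [set` J]) (X j @^-1` B j)) =
    (\prod_(j in J) P (X j @^-1` B j))%E.

Definition independent_sigma F G : Prop :=
  forall A B, F A -> G B -> P (A `&` B) = (P A * P B)%E.

(* sigma{ X_k : k in K } for a family of random vectors. *)
Definition sigma_gen (m : nat) (K : set nat) (X : nat -> Omega -> 'cV[R]_m) :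
    set (set Omega) :=
  <<s [set A | exists k i (B : set R),
        [/\ K k, measurable B & A = (fun w => X k w i ord0) @^-1` B]] >>.

(* F_k = sigma{ w(t_1), ..., w(t_k) }; no generator when k = 0. *)
Definition filtration (m : nat) (W : nat -> Omega -> 'cV[R]_m) (k : nat) :
    set (set Omega) :=
  sigma_gen [set i | (0 < i <= k)%N] W.

Definition increment (m : nat) (W : nat -> Omega -> 'cV[R]_m) (k : nat)
    (w : Omega) : 'cV[R]_m := W k.+1 w - W k w.

(* W k stands for w(t_k), 0 <= k <= N+1; the values of W at larger indices are
   never used. *)
Record noise (h : R) (N m : nat) (W : nat -> Omega -> 'cV[R]_m) : Prop := {
  noise_rv : forall k, (k <= N.+1)%N -> measurable_vec_wrt measurable (W k) ;
  noise_start : forall w, W 0 w = 0 ;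
  noise_components : forall k, (k <= N)%N ->
    independent_rv (fun j w => increment W k w j ord0) ;
  noise_mean : forall k j, (k <= N)%N ->
    is_cond_expect (filtration W k)
      (fun w => increment W k w j ord0) (cst 0) ;
  noise_square : forall k j, (k <= N)%N ->
    is_cond_expect (filtration W k)
      (fun w => increment W k w j ord0 ^+ 2) (cst h) ;
  noise_fourth : forall k j, (k <= N)%N ->
    ('E_P[fun w => (increment W k w j ord0 ^+ 4)%R] < +oo)%E ;
  noise_cov : forall k i j, (k <= N)%N ->
    'E_P[fun w => (increment W k w i ord0 * increment W k w j ord0)%R]%E
      = (h * (i == j)%:R)%:E ;
  noise_future : forall k, (k <= N)%N ->
    independent_sigma (filtration W k)
      (sigma_gen [set i | (k < i <= N)%N] (increment W)) }.

End Probability.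

(* The coefficients are only evaluated at the grid times t_0, ..., t_N. *)
Record control_problem (R : realType) (n r m : nat) := ControlProblem {
  t_start : R ;
  step : R ;
  horizon : nat ;
  drift : R -> 'cV[R]_n -> 'cV[R]_n -> 'cV[R]_r -> 'cV[R]_n ;
  diffusion : 'I_m -> R -> 'cV[R]_n -> 'cV[R]_n -> 'cV[R]_r -> 'cV[R]_n ;
  running_cost : R -> 'cV[R]_n -> 'cV[R]_n -> 'cV[R]_r -> R ;
  terminal_cost : 'cV[R]_n -> 'cV[R]_n -> R ;
  control_set : R -> set 'cV[R]_r ;
  initial_state : 'cV[R]_n }.

Definition grid (R : realType) (n r m : nat) (pb : control_problem R n r m)
    (k : nat) : R := t_start pb + k%:R * step pb.

Section Regularity.
Context {R : realType} {n r : nat} {V : normedModType R}.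

Definition lipschitz_bounded (L : R)
    (psi : 'cV[R]_n -> 'cV[R]_n -> 'cV[R]_r -> V) : Prop :=
  (forall x1 x2 y1 y2 u1 u2,
     `|psi x1 y1 u1 - psi x2 y2 u2| <=
       L * (`|x1 - x2| + `|y1 - y2| + `|u1 - u2|)) /\
  `|psi 0 0 0| <= L.

Definition uncurry3 (psi : 'cV[R]_n -> 'cV[R]_n -> 'cV[R]_r -> V)
    (z : 'cV[R]_n * 'cV[R]_n * 'cV[R]_r) : V := psi z.1.1 z.1.2 z.2.

(* In finite dimension, continuity of the differential is continuity of its
   value in every fixed direction. *)
Definition continuously_differentiable
    (psi : 'cV[R]_n -> 'cV[R]_n -> 'cV[R]_r -> V) : Prop :=
  (forall z, differentiable (uncurry3 psi) z) /\
  (forall v, continuous (fun z => 'd (uncurry3 psi) z v)).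

End Regularity.

Section Assumptions.
Context {R : realType} {n r m : nat}.
Variable pb : control_problem R n r m.
Let tk := grid pb.

(* phi(x, y), seen as a function of (x, y, u) that does not depend on u. *)
Definition terminal_cost_xyu (x y : 'cV[R]_n) (u : 'cV[R]_r) : R^o :=
  terminal_cost pb x y.

Definition assumption_A1 : Prop :=
  exists2 L : R, 0 < L &
    (forall k, (k <= horizon pb)%N ->
      [/\ lipschitz_bounded L (drift pb (tk k)),
          forall j, lipschitz_bounded L (diffusion pb j (tk k)) &
          lipschitz_bounded (V := R^o) L (running_cost pb (tk k))]) /\
    lipschitz_bounded L terminal_cost_xyu.

Definition assumption_A2 : Prop :=
  ((forall k, (k <= horizon pb)%N ->
      [/\ continuously_differentiable (drift pb (tk k)),
          forall j, continuously_differentiable (diffusion pb j (tk k)) &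
          continuously_differentiable (V := R^o) (running_cost pb (tk k))]) /\
   continuously_differentiable terminal_cost_xyu) /\
  exists2 L1 : R, 0 < L1 &
    (forall k, (k <= horizon pb)%N ->
      [/\ lipschitz_bounded L1 (fun x y u =>
            jacobian_mx (fun x' => drift pb (tk k) x' y u) x),
          forall j, lipschitz_bounded L1 (fun x y u =>
            jacobian_mx (fun x' => diffusion pb j (tk k) x' y u) x) &
          lipschitz_bounded L1 (fun x y u =>
            gradient (fun x' => running_cost pb (tk k) x' y u) x)]) /\
    lipschitz_bounded L1 (fun x y (u : 'cV[R]_r) =>
      gradient (fun x' => terminal_cost pb x' y) x).

Definition assumption_A3 : Prop :=
  forall k, (k <= horizon pb)%N -> convex_set (control_set pb (tk k)).

End Assumptions.

Section Control.
Context {disp : measure_display} {Omega : measurableType disp} {R : realType}.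
Context {n r m : nat}.
Variables (P : probability Omega R) (pb : control_problem R n r m).
Variable W : nat -> Omega -> 'cV[R]_m.
Let tk := grid pb.
Let h := step pb.
Let N := horizon pb.

(* Processes are indexed by the step number: u k is u(t_k).  As elements of L^2
   are classes modulo equality a.s., u(t) \in U(t) is required almost surely. *)
Definition admissible (u : nat -> Omega -> 'cV[R]_r) : Prop :=
  forall k, (k <= N)%N ->
    L2_vec P (filtration W k) (u k) /\
    {ae P, forall w, control_set pb (tk k) (u k w)}.

Fixpoint state (u : nat -> Omega -> 'cV[R]_r) (k : nat) : Omega -> 'cV[R]_n :=
  if k is k'.+1 then
    let x := state u k' in fun w =>
      x w + h *: drift pb (tk k') (x w) (expect_vec P x) (u k' w)
      + \sum_(j < m) increment W k' w j ord0 *: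
          diffusion pb j (tk k') (x w) (expect_vec P x) (u k' w)
  else fun=> initial_state pb.

Definition cost (u : nat -> Omega -> 'cV[R]_r) : \bar R :=
  let x := state u in
  ('E_P[fun w => terminal_cost pb (x N.+1 w) (expect_vec P (x N.+1))]
   + 'E_P[fun w => (\sum_(k < N.+1)
       running_cost pb (tk k) (x k w) (expect_vec P (x k)) (u k w))%R])%E.

Definition optimal_pair (x : nat -> Omega -> 'cV[R]_n)
    (u : nat -> Omega -> 'cV[R]_r) : Prop :=
  [/\ admissible u,
      forall k, (k <= N.+1)%N -> x k = state u k &
      forall u', admissible u' -> (cost u <= cost u')%E].

Section Along.
Variables (x : nat -> Omega -> 'cV[R]_n) (u : nat -> Omega -> 'cV[R]_r).

(* (f, sigma^1, ..., sigma^d, l)(t_k, x(t_k), E x(t_k), v), the vectors sigma^j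
   being the columns of a matrix. *)
Definition velocity (k : nat) (w : Omega) (v : 'cV[R]_r) :
    'cV[R]_n * 'M[R]_(n, m) * R^o :=
  (drift pb (tk k) (x k w) (expect_vec P (x k)) v,
   \matrix_(i, j) diffusion pb j (tk k) (x k w) (expect_vec P (x k)) v i ord0,
   running_cost pb (tk k) (x k w) (expect_vec P (x k)) v).

Definition assumption_A4 : Prop :=
  forall k, (k <= N)%N ->
    {ae P, forall w, convex_set (velocity k w @` control_set pb (tk k))}.

Definition jac_x_along (psi : R -> 'cV[R]_n -> 'cV[R]_n -> 'cV[R]_r -> 'cV[R]_n)
    (k : nat) (w : Omega) : 'M[R]_n :=
  jacobian_mx (fun x' => psi (tk k) x' (expect_vec P (x k)) (u k w)) (x k w).

Definition jac_y_along (psi : R -> 'cV[R]_n -> 'cV[R]_n -> 'cV[R]_r -> 'cV[R]_n)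
    (k : nat) (w : Omega) : 'M[R]_n :=
  jacobian_mx (fun y' => psi (tk k) (x k w) y' (u k w)) (expect_vec P (x k)).

Definition grad_x_along (psi : R -> 'cV[R]_n -> 'cV[R]_n -> 'cV[R]_r -> R)
    (k : nat) (w : Omega) : 'cV[R]_n :=
  gradient (fun x' => psi (tk k) x' (expect_vec P (x k)) (u k w)) (x k w).

Definition grad_y_along (psi : R -> 'cV[R]_n -> 'cV[R]_n -> 'cV[R]_r -> R)
    (k : nat) (w : Omega) : 'cV[R]_n :=
  gradient (fun y' => psi (tk k) (x k w) y' (u k w)) (expect_vec P (x k)).

(* The integrability clauses are what makes E{p(t+h) | F_t} and
   E{p(t+h) w_h^j(t) | F_t} meaningful. *)
Record adjoint_solution (p : nat -> Omega -> 'cV[R]_n)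
    (q : 'I_m -> nat -> Omega -> 'cV[R]_n) : Prop := {
  adj_p_adapted : forall k, (k <= N.+1)%N ->
    measurable_vec_wrt (filtration W k) (p k) ;
  adj_q_adapted : forall j k, (k <= N)%N ->
    measurable_vec_wrt (filtration W k) (q j k) ;
  adj_p_integrable : forall k, (k <= N)%N -> integrable_vec P (p k.+1) ;
  adj_pw_integrable : forall j k, (k <= N)%N ->
    integrable_vec P (fun w => increment W k w j ord0 *: p k.+1 w) ;
  adj_equation : forall k, (k <= N)%N -> {ae P, forall w,
    p k w =
      (1%:M + h *: (jac_x_along (drift pb) k w)^T)
        *m cond_expect_vec P (filtration W k) (p k.+1) w
      + h *: expect_vec P (fun w' =>
          (jac_y_along (drift pb) k w')^T *m p k.+1 w')
      + \sum_(j < m) (jac_x_along (diffusion pb j) k w)^T *m q j k w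
      + \sum_(j < m) expect_vec P (fun w' =>
          (jac_y_along (diffusion pb j) k w')^T *m q j k w')
      - grad_x_along (running_cost pb) k w
      - expect_vec P (grad_y_along (running_cost pb) k)} ;
  adj_terminal : {ae P, forall w,
    p N.+1 w =
      - gradient (fun x' => terminal_cost pb x' (expect_vec P (x N.+1)))
          (x N.+1 w)
      - expect_vec P (fun w' =>
          gradient (terminal_cost pb (x N.+1 w')) (expect_vec P (x N.+1)))} ;
  adj_martingale_part : forall j k, (k <= N)%N -> {ae P, forall w,
    q j k w = cond_expect_vec P (filtration W k)
      (fun w' => increment W k w' j ord0 *: p k.+1 w') w} }.

Definition hamiltonian (p : nat -> Omega -> 'cV[R]_n)
    (q : 'I_m -> nat -> Omega -> 'cV[R]_n) (k : nat) (w : Omega)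
    (v : 'cV[R]_r) : R :=
  dot (cond_expect_vec P (filtration W k) (p k.+1) w)
      (h *: drift pb (tk k) (x k w) (expect_vec P (x k)) v)
  + \sum_(j < m) dot (q j k w)
      (diffusion pb j (tk k) (x k w) (expect_vec P (x k)) v)
  - running_cost pb (tk k) (x k w) (expect_vec P (x k)) v.

End Along.
End Control.

(* Main.v *)
(** Along needle perturbations u + eps du, where du is integrable and
    vanishes except at a single time, the increments of the state
    and of its mean are O(eps) with an integrable constant: only
    E{(w_h^j)^2 | F_t} = h is needed to propagate this bound through a step.
    Since the coefficients have bounded differentials, the adjoint equation,
    solved backward, defines a bounded adapted process p, and so does q.  Pairing
    p(t + h) with the increment of the state and using conditional expectations
    (q absorbs the noise) turns the increment of E<p, dx> over one step into the
    expected variation of the running cost plus eps E<H_u, du>, up to a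
    remainder.  These identities telescope; the remainders, divided by eps,
    vanish in the limit by dominated convergence, so optimality gives
    E(1_A <H_u, v - u(t)>) <= 0 for every A in F_t, which is the claim because
    H_u(t, u(t)) is F_t-measurable. *)
Require Import Defs.
From HB Require Import structures.
From mathcomp Require Import all_boot all_order all_algebra.
From mathcomp Require Import all_classical all_reals all_analysis.
From mathcomp Require Import measurable_realfun ring lra.

Set Implicit Arguments.
Unset Strict Implicit.
Unset Printing Implicit Defensive.

Import Order.TTheory GRing.Theory Num.Theory.
Import numFieldNormedType.Exports.

Local Open Scope classical_set_scope.
Local Open Scope ring_scope.

(** * Integrable random variables and sub-sigma-algebras *)

(** Duality pairs two unequal classes: states, controls and perturbations are kept merely
    integrable, while the adjoint variables and the derivatives of the coefficients are essentially
    bounded, so that every pairing is integrable. The obstacle is the noise: the product of an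
    increment [w] with an integrable [F_t]-measurable variable is not obviously integrable. It
    becomes so from [|w| <= (1 + w^2) / 2], whose right-hand side has the constant conditional
    expectation [(1 + h) / 2], together with a pull-out rule that delivers integrability instead of
    presupposing it. The same inequality bounds [q]. The mean-field terms come from one exchange:
    [E<Y, E A> = <E Y, E A> = E<E Y, A>]. The Hamiltonian is treated as a linear form in the values
    of the coefficients: fed with differentials it gives the adjoint equation and [H_u], fed with
    Taylor remainders it gives the error term. The parameter eps runs through [1 / (i + 1)], so that
    all limits are limits of sequences. *)

Section IntegrableRV.
Context {disp : measure_display} {Omega : measurableType disp} {R : realType}.
Variable P : probability Omega R.
Implicit Types X Y : Omega -> R.
Let mT : measurable [set: Omega] := measurableT.

Lemma integrable_rv_measurable X :
  integrable_rv P X -> measurable_fun setT X.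
Proof. by move/measurable_int/measurable_EFinP. Qed.

Lemma integrable_rv_cst (c : R) : integrable_rv P (fun=> c).
Proof. exact: finite_measure_integrable_cst. Qed.

Lemma integrable_rvD X Y : integrable_rv P X -> integrable_rv P Y ->
  integrable_rv P (fun w => X w + Y w).
Proof. by move=> iX iY; have := integrableD mT iX iY. Qed.

Lemma integrable_rvB X Y : integrable_rv P X -> integrable_rv P Y ->
  integrable_rv P (fun w => X w - Y w).
Proof. by move=> iX iY; have := integrableB mT iX iY. Qed.

Lemma integrable_rvZ (c : R) X : integrable_rv P X ->
  integrable_rv P (fun w => c * X w).
Proof. by move=> iX; have := integrableZl mT c iX. Qed.

Lemma integrable_rv_sum (I : Type) (s : seq I) (X : I -> Omega -> R) :
  (forall i, integrable_rv P (X i)) ->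
  integrable_rv P (fun w => \sum_(i <- s) X i w).
Proof.
move=> iX; elim: s => [|i s ih].
  under eq_fun do rewrite big_nil; exact: integrable_rv_cst.
under eq_fun do rewrite big_cons; exact: integrable_rvD.
Qed.

Lemma integrable_rv_norm X : integrable_rv P X ->
  integrable_rv P (fun w => `|X w|).
Proof. exact: integrable_norm. Qed.

Lemma integrable_rv_ae_le X Y : measurable_fun setT X -> integrable_rv P Y ->
  {ae P, forall w, `|X w| <= Y w} -> integrable_rv P X.
Proof.
move=> mX iY XY; apply/integrableP; split; first exact/measurable_EFinP.
move/integrableP: (iY) => [mY]; apply: le_lt_trans.
apply: ae_ge0_le_integral => //.
- by apply: measurableT_comp => //; exact/measurable_EFinP.
- exact: measurableT_comp.
- by apply: filterS XY => w /= h _; rewrite lee_fin (le_trans h)// ler_norm.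
Qed.

Lemma integrable_rv_le X Y : measurable_fun setT X -> integrable_rv P Y ->
  (forall w, `|X w| <= Y w) -> integrable_rv P X.
Proof. by move=> mX iY XY; apply: (integrable_rv_ae_le mX iY); apply: aeW. Qed.

Lemma integrable_rvM_bounded X Y : integrable_rv P X -> measurable_fun setT Y ->
  (exists C : R, {ae P, forall w, `|Y w| <= C}) ->
  integrable_rv P (fun w => Y w * X w).
Proof.
move=> iX mY [C YC]; have mX := integrable_rv_measurable iX.
apply: (@integrable_rv_ae_le _ (fun w => C * `|X w|)).
- exact: measurable_funM.
- exact/integrable_rvZ/integrable_rv_norm.
- by apply: filterS YC => w /= YC; rewrite normrM ler_wpM2r.
Qed.

Lemma Rintegral_sum (I : Type) (s : seq I) (X : I -> Omega -> R) :
  (forall i, integrable_rv P (X i)) ->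
  \int[P]_w (\sum_(i <- s) X i w) = \sum_(i <- s) \int[P]_w X i w.
Proof.
move=> iX; elim: s => [|i s ih].
  by under eq_Rintegral do rewrite big_nil; rewrite Rintegral_cst ?mul0r ?big_nil.
under eq_Rintegral do rewrite big_cons.
rewrite big_cons RintegralD ?ih//; first exact: iX.
exact: (integrable_rv_sum s iX).
Qed.

Lemma integral_EFin X : integrable_rv P X ->
  (\int[P]_w (X w)%:E)%E = (\int[P]_w X w)%:E.
Proof. by move=> iX; rewrite fineK//; exact: integrable_fin_num. Qed.

Lemma Rintegral_cstT (c : R) : \int[P]_w c = c.
Proof.
by rewrite Rintegral_cst// (_ : fine _ = 1) ?mulr1//= probability_setT.
Qed.

Lemma Rintegral_aeE X Y : integrable_rv P X -> integrable_rv P Y ->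
  {ae P, forall w, X w = Y w} -> \int[P]_w X w = \int[P]_w Y w.
Proof.
move=> iX iY XY; congr fine; apply: ae_eq_integral => //.
- exact: measurable_int iX.
- exact: measurable_int iY.
- by apply: filterS XY => w /= ->.
Qed.

Lemma ae_le_Rintegral X Y : integrable_rv P X -> integrable_rv P Y ->
  {ae P, forall w, X w <= Y w} -> \int[P]_w X w <= \int[P]_w Y w.
Proof.
move=> iX iY XY; rewrite -subr_ge0 -RintegralB//.
have iXY : integrable_rv P (fun w => Y w - X w) by exact: integrable_rvB.
(* The difference is nonnegative only almost surely; its absolute value has the same integral and is
   nonnegative everywhere. *)
rewrite (@Rintegral_aeE _ (fun w => `|Y w - X w|))//.
- by apply: Rintegral_ge0 => w _.
- exact: integrable_rv_norm.
- by apply: filterS XY => w /= XY; rewrite ger0_norm// subr_ge0.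
Qed.

(** Convergence is asked everywhere and domination only almost surely: the Taylor remainders
    converge at every point, whereas weights taken from the adjoint process are bounded only up to a
    null set. *)
Lemma Rintegral_dominated (X_ : nat -> Omega -> R) X Y :
  (forall i, measurable_fun setT (X_ i)) -> measurable_fun setT X ->
  (forall w, X_ ^~ w @ \oo --> X w) ->
  integrable_rv P Y -> {ae P, forall w i, `|X_ i w| <= Y w} ->
  (\int[P]_w X_ i w) @[i --> \oo] --> \int[P]_w X w.
Proof.
move=> mX_ mX X_X iY X_Y.
have [||||iX _ cv] := @dominated_convergence _ _ _ P setT mT
   (fun i w => (X_ i w)%:E) (EFin \o X) (EFin \o Y) _ _ _ iY.
- by move=> i; exact/measurable_EFinP.
- exact/measurable_EFinP.
- by apply: aeW => w _; apply: cvg_EFin; [exact: nearW|exact: X_X].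
- by apply: filterS X_Y => w /= h i _; rewrite lee_fin.
apply/fine_cvg; rewrite fineK//; exact: integrable_fin_num.
Qed.

End IntegrableRV.

Section SubSigmaAlgebra.
Context {disp : measure_display} {Omega : measurableType disp} {R : realType}.
Variable G : set (set Omega).
Let S := g_sigma_algebraType G.
Implicit Types X Y : Omega -> R.

(** Passing to the type that carries the generated sigma-algebra gives access to the usual closure
    properties of measurable functions. *)
Lemma measurable_wrtP X :
  measurable_wrt <<s G >> X <-> measurable_fun setT (X : S -> R).
Proof.
split=> [mX _ B mB|mX B mB]; first by rewrite setTI; exact: mX.
by rewrite -[_ @^-1` _]setTI; exact: mX.
Qed.

Lemma measurable_wrt_cst (c : R) : measurable_wrt <<s G >> (fun=> c).
Proof. by apply/measurable_wrtP; exact: measurable_cst. Qed.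

Lemma measurable_wrtD X Y : measurable_wrt <<s G >> X ->
  measurable_wrt <<s G >> Y -> measurable_wrt <<s G >> (fun w => X w + Y w).
Proof.
by move=> /measurable_wrtP mX /measurable_wrtP mY; apply/measurable_wrtP;
  exact: measurable_funD.
Qed.

Lemma measurable_wrtM X Y : measurable_wrt <<s G >> X ->
  measurable_wrt <<s G >> Y -> measurable_wrt <<s G >> (fun w => X w * Y w).
Proof.
by move=> /measurable_wrtP mX /measurable_wrtP mY; apply/measurable_wrtP;
  exact: measurable_funM.
Qed.

Lemma measurable_wrtZ (c : R) X : measurable_wrt <<s G >> X ->
  measurable_wrt <<s G >> (fun w => c * X w).
Proof. by apply: measurable_wrtM; exact: measurable_wrt_cst. Qed.

Lemma measurable_wrtN X : measurable_wrt <<s G >> X ->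
  measurable_wrt <<s G >> (fun w => - X w).
Proof.
by move=> mX; under eq_fun do rewrite -mulN1r; exact: measurable_wrtZ.
Qed.

Lemma measurable_wrtB X Y : measurable_wrt <<s G >> X ->
  measurable_wrt <<s G >> Y -> measurable_wrt <<s G >> (fun w => X w - Y w).
Proof. by move=> mX mY; exact: measurable_wrtD mX (measurable_wrtN mY). Qed.

Lemma measurable_wrt_sum (I : Type) (s : seq I) (X : I -> Omega -> R) :
  (forall i, measurable_wrt <<s G >> (X i)) ->
  measurable_wrt <<s G >> (fun w => \sum_(i <- s) X i w).
Proof.
move=> iX; elim: s => [|i s ih].
  under eq_fun do rewrite big_nil; exact: measurable_wrt_cst.
under eq_fun do rewrite big_cons; exact: measurable_wrtD.
Qed.

Lemma measurable_wrt_norm X : measurable_wrt <<s G >> X ->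
  measurable_wrt <<s G >> (fun w => `|X w|).
Proof.
by move=> /measurable_wrtP mX; apply/measurable_wrtP; exact: measurableT_comp.
Qed.

Lemma measurable_wrt_lim (X_ : nat -> Omega -> R) X :
  (forall i, measurable_wrt <<s G >> (X_ i)) ->
  (forall w, X_ ^~ w @ \oo --> X w) -> measurable_wrt <<s G >> X.
Proof.
move=> mX_ X_X; apply/measurable_wrtP.
apply: (@measurable_fun_cvg _ S R setT X_) => [i|w _]; last exact: X_X.
exact/measurable_wrtP.
Qed.

End SubSigmaAlgebra.

Lemma measurable_wrt_sub {disp : measure_display} {Omega : measurableType disp}
    {R : realType} (F F' : set (set Omega)) (X : Omega -> R) :
  F `<=` F' -> measurable_wrt F X -> measurable_wrt F' X.
Proof. by move=> FF' mX B mB; exact/FF'/mX. Qed.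

Lemma measurable_wrt_measurable_fun {disp : measure_display}
    {Omega : measurableType disp} {R : realType} (F : set (set Omega))
    (X : Omega -> R) :
  F `<=` measurable -> measurable_wrt F X -> measurable_fun setT X.
Proof. by move=> FF' mX _ B mB; rewrite setTI; exact/FF'/mX. Qed.

(* The library has no Borel structure on column vectors; rounding the entries
   makes a measurable vector countably valued, and [g (X, U)] is a limit of
   functions of such vectors. *)
Section ContinuousComposition.
Context {disp : measure_display} {Omega : measurableType disp} {R : realType}.
Variables (G : set (set Omega)).

Definition round_vec (n : nat) (i : nat) (x : 'cV[R]_n) : 'cV[int]_n :=
  map_mx (fun a : R => Num.floor (a * i.+1%:R)) x.

Definition unround_vec (n : nat) (i : nat) (z : 'cV[int]_n) : 'cV[R]_n :=
  map_mx (fun a : int => a%:~R / i.+1%:R) z.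

Lemma cvg_unround_round (n : nat) (x : 'cV[R]_n) :
  unround_vec i (round_vec i x) @[i --> \oo] --> x.
Proof.
apply/cvgrPdist_le => e e0.
near=> i.
rewrite [leLHS]mx_normrE; apply: bigmax_le; first exact: ltW.
move=> [k j] _; rewrite !mxE /=.
set a := x k j.
have i0 : (0 : R) < i.+1%:R by rewrite ltr0n.
(* The floor is off by at most 1, so each entry moves by at most [1 / (i + 1)]. *)
have /andP[h1 h2] : (Num.floor (a * i.+1%:R))%:~R <= a * i.+1%:R
    < (Num.floor (a * i.+1%:R))%:~R + 1.
  by rewrite floor_le -intrD1 floorD1_gt.
have -> : a - (Num.floor (a * i.+1%:R))%:~R / i.+1%:R =
  (a * i.+1%:R - (Num.floor (a * i.+1%:R))%:~R) / i.+1%:R.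
  by rewrite mulrBl mulfK// gt_eqF.
rewrite normrM ger0_norm ?subr_ge0// normfV [X in _ / X]gtr0_norm//.
rewrite ler_pdivrMr//; apply: (@le_trans _ _ 1).
  by rewrite lerBlDl ltW.
rewrite -ler_pdivrMr// div1r.
rewrite ltW//; near: i; exact: (near_infty_natSinv_lt (PosNum e0)).
Unshelve. all: by end_near. Qed.

Lemma measurable_wrt_countable (T : countType) (Y : Omega -> T) (f : T -> R) :
  (forall t, <<s G >> (Y @^-1` [set t])) ->
  measurable_wrt <<s G >> (fun w => f (Y w)).
Proof.
move=> mY B mB.
(* The fibres over the values [t] with [f t] in [B], enumerated by the codes of [T]; the other codes
   contribute the empty set. *)
pose A k := if unpickle k is Some t then
  if pselect (B (f t)) then Y @^-1` [set t] else set0 else set0.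
suff -> : (fun w => f (Y w)) @^-1` B = \bigcup_k A k.
  apply: sigma_algebra_bigcup => k; rewrite /A.
  case E : (unpickle k) => [t|]; last exact: sigma_algebra0.
  by case: (pselect (B (f t))) => h; [exact: mY|exact: sigma_algebra0].
apply/seteqP; split=> w /=.
  by move=> Bw; exists (pickle (Y w)) => //; rewrite /A pickleK; case: pselect.
move=> [k _]; rewrite /A; case E : (unpickle k) => [t|//].
by case: (pselect (B (f t))) => [Bt /= ->|_ []].
Qed.

Lemma measurable_round_vec (n i : nat) (X : Omega -> 'cV[R]_n) z :
  measurable_vec_wrt <<s G >> X ->
  <<s G >> ((fun w => round_vec i (X w)) @^-1` [set z]).
Proof.
move=> mX.
have -> : (fun w => round_vec i (X w)) @^-1` [set z] =
  \bigcap_(k in [set: 'I_n]) (fun w => X w k ord0 * i.+1%:R) @^-1`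
     `[(z k ord0)%:~R, (z k ord0 + 1)%:~R[%classic.
  apply/seteqP; split=> w /=.
    by move=> <- k _ /=; rewrite in_itv/= mxE floor_itv.
  move=> h; apply/matrixP => k j; rewrite ord1 mxE; apply/eqP.
  by rewrite floor_eq; have := h k I; rewrite /= in_itv.
apply: (@fin_bigcap_measurable _ (g_sigma_algebraType G)) => // k _.
apply: measurable_wrtM; [exact: mX|exact: measurable_wrt_cst|].
exact: measurable_itv.
Qed.

Lemma measurable_wrt_continuous (n r : nat) (g : 'cV[R]_n * 'cV[R]_r -> R)
    (X : Omega -> 'cV[R]_n) (U : Omega -> 'cV[R]_r) :
  continuous g -> measurable_vec_wrt <<s G >> X ->
  measurable_vec_wrt <<s G >> U ->
  measurable_wrt <<s G >> (fun w => g (X w, U w)).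
Proof.
move=> cg mX mU.
pose g_ i w := g (unround_vec i (round_vec i (X w)),
                  unround_vec i (round_vec i (U w))).
apply: (@measurable_wrt_lim _ _ _ _ g_); last first.
  move=> w; have cXU : (unround_vec i (round_vec i (X w)),
      unround_vec i (round_vec i (U w))) @[i --> \oo] --> (X w, U w).
    have H := cvg_pair (@cvg_unround_round _ (X w))
      (@cvg_unround_round _ (U w)); apply: H.
  exact: (cvg_comp _ _ cXU (cg (X w, U w))).
move=> i; rewrite /g_.
apply: (@measurable_wrt_countable _ (fun w => (round_vec i (X w), round_vec i (U w)))
  (fun z => g (unround_vec i z.1, unround_vec i z.2))).
move=> [z1 z2]; rewrite (_ : _ @^-1` _ =
  (fun w => round_vec i (X w)) @^-1` [set z1] `&`
  (fun w => round_vec i (U w)) @^-1` [set z2]).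
  apply: (@measurableI _ (g_sigma_algebraType G)); exact: measurable_round_vec.
by apply/seteqP; split=> w /= [-> ->].
Qed.

End ContinuousComposition.

(** * Conditional expectation *)

Section ConditionalExpectation.
Context {disp : measure_display} {Omega : measurableType disp} {R : realType}.
Variables (P : probability Omega R) (G : set (set Omega)).
Hypothesis GM : <<s G >> `<=` measurable.
Let F : set (set Omega) := <<s G >>.
Implicit Types X Y Z : Omega -> R.

(** Tested on [{Z > 0}], which itself belongs to [F]: there [Z] is positive with a nonpositive
    integral, so this set is null. It serves both for the monotonicity of conditional expectation
    and for the final passage from integrated to almost sure inequalities. *)
Lemma ae_le0_sub_sigma Z : measurable_wrt F Z -> integrable_rv P Z ->
  (forall A, F A -> \int[P]_(w in A) Z w <= 0) ->
  {ae P, forall w, Z w <= 0}.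
Proof.
move=> mZ iZ hZ; pose A := [set w | 0 < Z w].
have FA : F A.
  have := mZ `]0, +oo[%classic (measurable_itv _).
  by congr F; apply/seteqP; split => w /=; rewrite in_itv/= andbT.
have mA : measurable A by exact: GM.
have iZA : P.-integrable A (EFin \o Z) by exact: integrableS iZ.
have : ae_eq P A (EFin \o Z) (cst 0%E).
  apply/ae_eq_integral_abs => //; first exact: measurable_int iZA.
  transitivity (\int[P]_(w in A) (Z w)%:E)%E.
    by apply: eq_integral => w; rewrite inE /A/= => ?; rewrite gtr0_norm.
  have fZ := integrable_fin_num mA iZA.
  rewrite -(fineK fZ); congr EFin; apply/eqP; rewrite eq_le; apply/andP; split.
    exact: hZ.
  by apply: Rintegral_ge0 => w; exact: ltW.
apply: filterS => w /= h; rewrite leNgt; apply/negP => Aw.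
by have [Z0] := h Aw; move: Aw; rewrite Z0 ltxx.
Qed.

Lemma cond_expect_restrict X Y A : is_cond_expect P F X Y -> F A ->
  \int[P]_(w in A) Y w = \int[P]_(w in A) X w.
Proof. by move=> [_ _ _ XY] FA; rewrite /Rintegral XY. Qed.

(** Concerns arbitrary versions: [Y - Y'] is [F]-measurable, and on each set of [F] it has the
    integral of [X - X']. *)
Lemma cond_expect_mono X Y X' Y' : is_cond_expect P F X Y ->
  is_cond_expect P F X' Y' -> {ae P, forall w, X w <= X' w} ->
  {ae P, forall w, Y w <= Y' w}.
Proof.
move=> XY XY' XX'; have [iX iY mY _] := XY; have [iX' iY' mY' _] := XY'.
have : {ae P, forall w, Y w - Y' w <= 0}.
  apply: ae_le0_sub_sigma; first exact: measurable_wrtB.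
    exact: integrable_rvB.
  move=> A FA; have mA : measurable A by exact: GM.
  have iA Z : integrable_rv P Z -> P.-integrable A (EFin \o Z).
    by move=> iZ; exact: integrableS iZ.
  rewrite RintegralB//; [|exact: iA..].
  rewrite (cond_expect_restrict XY)// (cond_expect_restrict XY')//.
  rewrite -RintegralB//; [|exact: iA..].
  rewrite Rintegral_mkcond -(Rintegral_cstT P 0); apply: ae_le_Rintegral.
  - rewrite /integrable_rv -restrict_EFin; apply/(integrable_mkcond _ mA).
    exact: iA (integrable_rvB iX iX').
  - exact: integrable_rv_cst.
  - apply: filterS XX' => w /= h; rewrite /patch; case: ifPn => // _.
    by rewrite subr_le0.
by apply: filterS => w /=; rewrite subr_le0.
Qed.

Lemma is_cond_expectD X Y X' Y' : is_cond_expect P F X Y ->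
  is_cond_expect P F X' Y' ->
  is_cond_expect P F (fun w => X w + X' w) (fun w => Y w + Y' w).
Proof.
move=> [iX iY mY XY] [iX' iY' mY' XY']; split.
- exact: integrable_rvD.
- exact: integrable_rvD.
- exact: measurable_wrtD.
- move=> A FA; have mA : measurable A by exact: GM.
  have iA Z : integrable_rv P Z -> P.-integrable A (EFin \o Z).
    by move=> iZ; exact: integrableS iZ.
  under eq_integral do rewrite EFinD.
  under [RHS]eq_integral do rewrite EFinD.
  by rewrite !integralD_EFin//; [rewrite XY// XY'|exact: iA..].
Qed.

Lemma is_cond_expectZ (c : R) X Y : is_cond_expect P F X Y ->
  is_cond_expect P F (fun w => c * X w) (fun w => c * Y w).
Proof.
move=> [iX iY mY XY]; split.
- exact: integrable_rvZ.
- exact: integrable_rvZ.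
- exact: measurable_wrtZ.
- move=> A FA; have mA : measurable A by exact: GM.
  have iA Z : integrable_rv P Z -> P.-integrable A (EFin \o Z).
    by move=> iZ; exact: integrableS iZ.
  under eq_integral do rewrite EFinM.
  under [RHS]eq_integral do rewrite EFinM.
  by rewrite !integralZl//; [rewrite XY|exact: iA..].
Qed.

Lemma is_cond_expect_cst (c : R) : is_cond_expect P F (fun=> c) (fun=> c).
Proof.
split; [exact: integrable_rv_cst..|exact: measurable_wrt_cst|by []].
Qed.

End ConditionalExpectation.

(** * Existence of conditional expectations by the Radon-Nikodym theorem *)

Section Existence.
Context {disp : measure_display} {Omega : measurableType disp} {R : realType}.
Variables (P : probability Omega R) (G : set (set Omega)).
Hypothesis GM : <<s G >> `<=` measurable.
Let S := g_sigma_algebraType G.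

(** The identity as a map into [Omega] with the smaller sigma-algebra; its law is the restriction of
    [P]. *)
Let idS (w : Omega) : S := w.

Let measurable_idS : measurable_fun setT idS.
Proof. by move=> _ A mA; rewrite setTI; exact: GM. Qed.

HB.instance Definition _ := isMeasurableFun.Build _ _ _ _ idS measurable_idS.

Variable X : Omega -> R.
Hypothesis iX : integrable_rv P X.

Let nu : set S -> \bar R := fun A => (\int[P]_(w in A) (X w)%:E)%E.

Let nu0 : nu set0 = 0%E. Proof. exact: integral_set0. Qed.

Let nu_fin : fin_num_fun nu.
Proof.
move=> A FA; apply: (integrable_fin_num (GM FA)).
exact: integrableS measurableT (GM FA) _ iX.
Qed.

Let nu_sigma_additive : semi_sigma_additive nu.
Proof.
move=> A FA tA FUA.
exact: (@charge_semi_sigma_additive _ _ _ (induced_charge iX) A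
  (fun i => GM (FA i)) tA (GM FUA)).
Qed.

HB.instance Definition _ := isCharge.Build _ _ _ nu nu0 nu_fin nu_sigma_additive.

Let nuP : nu `<< distribution P idS.
Proof.
apply/null_content_dominatesP => A FA PA0.
apply: null_set_integral => //; first exact: GM.
by apply: measurable_funTS; exact: measurable_int iX.
Qed.

(** The version is the density of [nu] with respect to the restriction of [P]. As a function on [S]
    it is measurable for the sub-sigma-algebra, and it is finite everywhere, so [fine] loses
    nothing. *)
Lemma is_cond_expect_exists : exists Y, is_cond_expect P <<s G >> X Y.
Proof.
pose f : S -> \bar R := Radon_Nikodym nu (distribution P idS).
have iF : (distribution P idS).-integrable setT f by exact: Radon_Nikodym_integrable.
have fE' w : f w = (fine (f w))%:E.
  by rewrite fineK//; exact: Radon_Nikodym_fin_num.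
have mf : measurable_fun setT f by exact: measurable_int iF.
have mY : measurable_wrt <<s G >> (fun w => fine (f w)).
  apply/measurable_wrtP; apply: measurableT_comp mf.
  exact: fine_measurable.
have fE : f = EFin \o (fine \o f) by apply/funext => w; rewrite /= -fE'.
have iY : integrable_rv P (fun w => fine (f w)).
  rewrite /integrable_rv -[X in integrable _ _ X]/(EFin \o (fine \o f)) -fE.
  apply/integrableP; split; first exact: (measurableT_comp mf measurable_idS).
  move/integrableP : iF => [_].
  by rewrite ge0_integral_distribution//; exact: measurableT_comp.
exists (fun w => fine (f w)); split => // A FA.
transitivity (\int[P]_(w in idS @^-1` A) (f \o idS) w)%E.
  by apply: eq_integral => w _; rewrite /= -fE'.
rewrite -[RHS]/(nu A) (Radon_Nikodym_integral nuP FA) -integral_pushforward//.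
rewrite /comp; apply: integrableS (measurableT) (GM FA) _ _ => //.
by rewrite fE.
Qed.

End Existence.

(** * Pulling measurable factors out of conditional expectations *)

Section PullOut.
Context {disp : measure_display} {Omega : measurableType disp} {R : realType}.
Variables (P : probability Omega R) (G : set (set Omega)).
Hypothesis GM : <<s G >> `<=` measurable.
Let S := g_sigma_algebraType G.
Let F : set (set Omega) := <<s G >>.
Implicit Types X Y Z : Omega -> R.
Import HBNNSimple.

Let measurableF X : measurable_wrt F X -> measurable_fun setT X.
Proof. exact: measurable_wrt_measurable_fun. Qed.

Lemma Rintegral_indicM A X :
  \int[P]_w (\1_A w * X w) = \int[P]_(w in A) X w.
Proof.
rewrite [RHS]Rintegral_mkcond; apply: eq_Rintegral => w _.
by rewrite patchE indicE; case: ifPn => _; rewrite ?mul1r ?mul0r.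
Qed.

Lemma integrable_indicM A X : measurable A -> integrable_rv P X ->
  integrable_rv P (fun w => \1_A w * X w).
Proof.
move=> mA iX; apply: integrable_rvM_bounded => //.
by exists 1; apply: aeW => w; rewrite indicE; case: (_ \in _);
  rewrite ?normr1 ?normr0.
Qed.

Let range_seq (g : {nnsfun S >-> R}) : seq R :=
  finmap.enum_fset (fset_set (range g)).

Let nnsfun_sum (g : {nnsfun S >-> R}) (w : Omega) : g w =
  \sum_(y <- range_seq g) y * \1_(g @^-1` [set y]) w.
Proof. by rewrite fimfunE fsbig_finite. Qed.

Let F_nnsfun (g : {nnsfun S >-> R}) y : F ((fun w : Omega => g w) @^-1` [set y]).
Proof.
have mg : measurable_fun setT (g : S -> R) by [].
by have := mg measurableT [set y] (measurable_set1 y); rewrite setTI.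
Qed.

Lemma nnsfunM_integrable (g : {nnsfun S >-> R}) X : integrable_rv P X ->
  integrable_rv P (fun w => g w * X w).
Proof.
move=> iX; under eq_fun do rewrite nnsfun_sum big_distrl /=.
apply: integrable_rv_sum => y; under eq_fun do rewrite -mulrA.
apply: integrable_rvZ; apply: integrable_indicM => //.
by apply: GM; exact: F_nnsfun.
Qed.

(** By linearity it suffices to treat the level sets of [g], which belong to [F]. *)
Lemma pull_out_nnsfun (g : {nnsfun S >-> R}) X Y : is_cond_expect P F X Y ->
  \int[P]_w (g w * X w) = \int[P]_w (g w * Y w).
Proof.
move=> XY; have [iX iY _ _] := XY.
have gE Z : integrable_rv P Z -> \int[P]_w (g w * Z w) =
   \sum_(y <- range_seq g) y * \int[P]_(w in g @^-1` [set y]) Z w.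
  move=> iZ; have i1 y : integrable_rv P (fun w => \1_(g @^-1` [set y]) w * Z w).
    by apply: integrable_indicM => //; apply: GM; exact: F_nnsfun.
  rewrite -[LHS]/(Rintegral P setT (fun w => _)).
  rewrite (_ : (fun w => g w * Z w) = fun w => \sum_(y <- range_seq g)
     y * (\1_(g @^-1` [set y]) w * Z w)).
    rewrite Rintegral_sum; last by move=> y; exact: integrable_rvZ.
    apply: eq_bigr => y _; rewrite RintegralZl//; last exact: i1.
    by congr (_ * _); exact: Rintegral_indicM.
  apply/funext => w; rewrite nnsfun_sum big_distrl; apply: eq_bigr => y _.
  by rewrite /= mulrA.
rewrite !gE//; apply: eq_bigr => y _; congr (_ * _).
exact: esym (cond_expect_restrict XY (F_nnsfun g y)).
Qed.

(** Simple functions for the sub-sigma-algebra. Their monotonicity serves monotone convergence, and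
    staying below [Z] gives domination by [|Z T|]. *)
Lemma nnsfun_approx_exists Z : measurable_wrt F Z -> (forall w, 0 <= Z w) ->
  exists g : {nnsfun S >-> R}^nat, [/\ forall w, nondecreasing_seq (g ^~ w),
    forall i w, g i w <= Z w & forall w, g ^~ w @ \oo --> Z w].
Proof.
move=> /measurable_wrtP mZ Z0.
have mZ' : measurable_fun setT (EFin \o (Z : S -> R)) by exact/measurable_EFinP.
pose g := nnsfun_approx measurableT mZ'; exists g.
have gZ w : g ^~ w @ \oo --> Z w.
  have Z0' t : setT t -> (0 <= (EFin \o (Z : S -> R)) t)%E by rewrite lee_fin.
  exact: fine_cvg (cvg_nnsfun_approx measurableT mZ' Z0' (I : setT w)).
have ndg w : nondecreasing_seq (g ^~ w).
  by move=> i j ij; exact/lefP/nd_nnsfun_approx.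
split=> // i w; rewrite -(cvg_lim _ (gZ w))//.
apply: nondecreasing_cvgn_le => //; apply/cvg_ex; eexists; exact: gZ.
Qed.

(* No integrability of [Z * X] is assumed: it comes out of monotone
   convergence along simple functions. *)
Lemma pull_out_integrable Z X Y : measurable_wrt F Z -> (forall w, 0 <= Z w) ->
  (forall w, 0 <= X w) -> is_cond_expect P F X Y ->
  integrable_rv P (fun w => Z w * Y w) -> integrable_rv P (fun w => Z w * X w).
Proof.
move=> mZ Z0 X0 XY iZY; have [iX iY _ _] := XY.
have [g [ndg gZ cvg_g]] := nnsfun_approx_exists mZ Z0.
have mX := integrable_rv_measurable iX.
have mg i : measurable_fun [set: Omega] (g i).
  by apply: measurableF; apply/measurable_wrtP.
apply/integrableP; split.
  by apply/measurable_EFinP; apply: measurable_funM => //; exact: measurableF.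
under eq_integral => w _ do rewrite /= ger0_norm ?mulr_ge0//.
have cvX : (\int[P]_w (g i w * X w)%:E)%E @[i --> \oo] -->
    (\int[P]_w (Z w * X w)%:E)%E.
  rewrite (_ : (\int[P]_w (Z w * X w)%:E)%E =
      (\int[P]_w limn (fun i => (g i w * X w)%:E))%E); last first.
    apply: eq_integral => w _; apply/esym/cvg_lim => //.
    apply: cvg_EFin; first exact: nearW.
    by apply: cvgM; [exact: cvg_g|exact: cvg_cst].
  apply: (@cvg_monotone_convergence _ _ _ P setT measurableT
    (fun i w => (g i w * X w)%:E)).
  - by move=> i; apply/measurable_EFinP; exact: measurable_funM.
  - by move=> i w _; rewrite lee_fin mulr_ge0.
  - by move=> w _ i j ij; rewrite lee_fin ler_wpM2r//; exact: ndg.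
have iYfin := integrable_fin_num measurableT iZY.
apply: (@le_lt_trans _ _ (\int[P]_w (Z w * Y w)%:E)%E); last first.
  by rewrite ltey_eq iYfin.
rewrite -(cvg_lim _ cvX)//; apply: lime_le; first by apply/cvg_ex; eexists; exact: cvX.
apply: nearW => i.
have gfin T : integrable_rv P T -> (\int[P]_w (g i w * T w)%:E)%E =
    (\int[P]_w (g i w * T w))%:E.
  by move=> iT; rewrite fineK//; apply/integrable_fin_num => //;
    exact: nnsfunM_integrable.
(* For simple factors the integrals against [X] and [Y] agree, and the latter is at most [E(Z Y)]
   because [Y] is almost surely nonnegative. *)
rewrite gfin// (pull_out_nnsfun _ XY) -(fineK iYfin) lee_fin.
apply: ae_le_Rintegral => //; first exact: nnsfunM_integrable.
have : {ae P, forall w, 0 <= Y w}.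
  exact: cond_expect_mono (is_cond_expect_cst P G 0) XY (aeW _ X0).
by apply: filterS => w Y0; rewrite ler_wpM2r.
Qed.

(** Dominated convergence along simple functions, on both sides. The factor [Z] may be unbounded, so
    the integrability of the two products is a separate assumption. *)
Lemma pull_out Z X Y : measurable_wrt F Z -> is_cond_expect P F X Y ->
  integrable_rv P (fun w => Z w * X w) -> integrable_rv P (fun w => Z w * Y w) ->
  \int[P]_w (Z w * X w) = \int[P]_w (Z w * Y w).
Proof.
move=> mZ XY iZX iZY; have [iX iY _ _] := XY.
(* Signed factors reduce to nonnegative ones by [2 Z = (|Z| + Z) - (|Z| - Z)]. *)
wlog Z0 : Z mZ iZX iZY / forall w, 0 <= Z w.
  move=> wlogZ.
  have mp : measurable_wrt F (fun w => `|Z w| + Z w).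
    exact: measurable_wrtD (measurable_wrt_norm mZ) mZ.
  have mn : measurable_wrt F (fun w => `|Z w| - Z w).
    exact: measurable_wrtB (measurable_wrt_norm mZ) mZ.
  have in_ T : integrable_rv P T -> integrable_rv P (fun w => Z w * T w) ->
      integrable_rv P (fun w => `|Z w| * T w).
    move=> iT iZT; apply: (integrable_rv_le _ (integrable_rv_norm iZT)).
      apply: measurable_funM; last exact: integrable_rv_measurable iT.
      exact: measurableF (measurable_wrt_norm mZ).
    by move=> w; rewrite !normrM normr_id.
  have ip T : integrable_rv P T -> integrable_rv P (fun w => Z w * T w) ->
      integrable_rv P (fun w => (`|Z w| + Z w) * T w).
    move=> iT iZT; under eq_fun do rewrite mulrDl.
    exact: integrable_rvD (in_ _ iT iZT) iZT.
  have im T : integrable_rv P T -> integrable_rv P (fun w => Z w * T w) ->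
      integrable_rv P (fun w => (`|Z w| - Z w) * T w).
    move=> iT iZT; under eq_fun do rewrite mulrBl.
    exact: integrable_rvB (in_ _ iT iZT) iZT.
  have ZE T : integrable_rv P T -> integrable_rv P (fun w => Z w * T w) ->
      2 * \int[P]_w (Z w * T w) = \int[P]_w ((`|Z w| + Z w) * T w) -
      \int[P]_w ((`|Z w| - Z w) * T w).
    move=> iT iZT; rewrite -RintegralB ?ip ?im// -RintegralZl//.
    by apply: eq_Rintegral => w _; ring.
  apply: (@mulfI _ 2) => //; rewrite !ZE//; congr (_ - _); apply: wlogZ => //.
  - exact: ip.
  - exact: ip.
  - by move=> w; rewrite -lerBlDr sub0r ler_normlW// normrN.
  - exact: im.
  - exact: im.
  - by move=> w; rewrite subr_ge0 ler_norm.
have [g [ndg gZ cvg_g]] := nnsfun_approx_exists mZ Z0.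
have mg i : measurable_fun [set: Omega] (g i).
  by apply: measurableF; apply/measurable_wrtP.
have cv T : integrable_rv P T -> integrable_rv P (fun w => Z w * T w) ->
    (\int[P]_w (g i w * T w)) @[i --> \oo] --> \int[P]_w (Z w * T w).
  move=> iT iZT; have mT := integrable_rv_measurable iT.
  apply: (@Rintegral_dominated _ _ _ P (fun i w => g i w * T w)
    (fun w => Z w * T w) (fun w => `|Z w * T w|)).
  - by move=> i; exact: measurable_funM.
  - exact: integrable_rv_measurable iZT.
  - by move=> w; apply: cvgM; [exact: cvg_g|exact: cvg_cst].
  - exact: integrable_rv_norm.
  - apply: aeW => w i; rewrite !normrM ler_wpM2r// !ger0_norm//.
have := cv X iX iZX; under eq_cvg do rewrite (pull_out_nnsfun _ XY).
by move=> cX; exact: (cvg_unique _ cX (cv Y iY iZY)).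
Qed.

End PullOut.

(** * Differentials of Lipschitz maps *)

Section Calculus.
Context {R : realType} {V W : normedModType R}.
Implicit Types (f : V -> W) (z v : V).

(** The difference quotients along [v] are bounded by [L |v|], hence so is their limit. This turns
    (A1) into bounds on the derivatives, and so on the adjoint process. *)
Lemma diff_le_lipschitz f (L : R) z v :
  (forall a b, `|f a - f b| <= L * `|a - b|) -> differentiable f z ->
  `|'d f z v| <= L * `|v|.
Proof.
move=> fL df; rewrite -(deriveE v df).
have dv : derivable f z v by exact: diff_derivable.
have /cvg_norm cv : h^-1 *: (f (h *: v + z) - f z) @[h --> 0^'] --> 'D_v f z.
  exact: dv.
rewrite -(cvg_lim _ cv)//; apply: limr_le; first by apply/cvg_ex; eexists; exact: cv.
near=> h; rewrite normrZ normfV ler_pdivrMl ?normr_gt0; last first.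
  by near: h; exact: nbhs_dnbhs_neq.
by rewrite (le_trans (fL _ _))// addrK normrZ mulrCA.
Unshelve. all: by end_near. Qed.

Lemma diff_remainder_cvg0 f z (D : R) (dz : nat -> V) : differentiable f z ->
  (forall i, i.+1%:R * `|dz i| <= D) ->
  i.+1%:R *: (f (z + dz i) - f z - 'd f z (dz i)) @[i --> \oo] --> (0 : W).
Proof.
move=> df dzD.
have D0 : 0 <= D by apply: le_trans (dzD 0%N); rewrite mulr_ge0.
apply/cvgr0Pnorm_le => e e0.
(* [D + 1] instead of [D], since [D] may be 0. *)
have e'0 : 0 < e / (D + 1) by rewrite divr_gt0// ltr_wpDl.
move/diff_locally/eqaddoP : df => /(_ _ e'0)/nbhs_ballP[d /= d0 hd].
near=> i; have i0 : (0 : R) < i.+1%:R by [].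
(* As [|dz i| <= D / (i + 1)], this holds as soon as [i + 1 > D / d]. *)
have dzd : ball 0 d (dz i).
  rewrite -ball_normE /= sub0r normrN -(ltr_pM2l i0) (le_lt_trans (dzD i))//.
  rewrite -ltr_pdivrMr//; near: i.
  exists (Num.truncn (D / d)) => // j /= hj.
  rewrite (lt_le_trans (truncnS_gt _))// ler_nat.
  by rewrite ltnS.
have h := hd _ dzd.
have -> : f (z + dz i) - f z - 'd f z (dz i) =
    (f \o shift z - (cst (f z) + 'd f z)) (dz i).
  by rewrite /= !fctE /= [dz i + z]addrC opprD addrA.
rewrite normrZ gtr0_norm// (le_trans (ler_wpM2l (ltW i0) h))//.
rewrite mulrCA (le_trans (ler_wpM2l (ltW e'0) (dzD i)))//.
by rewrite mulrAC ler_pdivrMr ?ltr_wpDl// ler_wpM2l ?ltW// ltrDl.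
Unshelve. all: by end_near. Qed.

(** One [L] comes from the increment of [f], the other from its differential. This uniform bound
    lets the preceding limit pass under the expectation. *)
Lemma diff_remainder_le f (L : R) z v :
  (forall a b, `|f a - f b| <= L * `|a - b|) -> differentiable f z ->
  `|f (z + v) - f z - 'd f z v| <= 2 * L * `|v|.
Proof.
move=> fL df; rewrite (le_trans (ler_normB _ _))// -mulrA mulr_natl mulr2n.
rewrite lerD ?diff_le_lipschitz// (le_trans (fL _ _))//.
by rewrite addrC addKr.
Qed.

End Calculus.

Section Components.
Context {R : realType} {V : normedModType R} {p : nat}.
Implicit Types (f : V -> 'cV[R]_p).

Lemma coord_is_diff f z i : differentiable f z ->
  is_diff z ((fun x => f x i ord0) : V -> R^o) (fun v => 'd f z v i ord0).
Proof.
move=> df.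
pose c0 (x : 'cV[R]_p) : R^o := x i ord0.
have lin_c0 : linear c0 by move=> a x y; rewrite /c0 !mxE.
pose c : {linear 'cV[R]_p -> R^o} :=
  HB.pack c0 (GRing.isLinear.Build _ _ _ _ c0 lin_c0).
have cc : continuous c by move=> x; exact: (@coord_continuous R p 1 i ord0 x).
have dc : differentiable c (f z) by exact: linear_differentiable.
have -> : (fun v => 'd f z v i ord0) = 'd (c \o f) z :> (V -> R).
  by rewrite (diff_comp df dc) (diff_lin _ cc).
exact/differentiableP/(differentiable_comp df dc).
Qed.

End Components.

(** * Partial derivatives as directional derivatives of the joint map *)

Section Partial.
Context {R : realType} {n r : nat} {W : normedModType R}.
Variable g : 'cV[R]_n * 'cV[R]_n * 'cV[R]_r -> W.

Let slice1 x y u v : (fun h : R => h^-1 *: (g (h *: v + x, y, u) - g (x, y, u)))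
  = (fun h => h^-1 *: (g (h *: (v, 0, 0) + (x, y, u)) - g (x, y, u))).
Proof.
apply/funext => h; congr (_ *: (g _ - _)).
by congr (_, _, _); rewrite /= scaler0 add0r.
Qed.

Let slice2 x y u v : (fun h : R => h^-1 *: (g (x, h *: v + y, u) - g (x, y, u)))
  = (fun h => h^-1 *: (g (h *: (0, v, 0) + (x, y, u)) - g (x, y, u))).
Proof.
apply/funext => h; congr (_ *: (g _ - _)).
by congr (_, _, _); rewrite /= scaler0 add0r.
Qed.

Let slice3 x y u v : (fun h : R => h^-1 *: (g (x, y, h *: v + u) - g (x, y, u)))
  = (fun h => h^-1 *: (g (h *: (0, 0, v) + (x, y, u)) - g (x, y, u))).
Proof.
apply/funext => h; congr (_ *: (g _ - _)).
by congr (_, _, _); rewrite /= scaler0 add0r.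
Qed.

Lemma derive_partial1 x y u (v : 'cV[R]_n) :
  'D_v (fun x' => g (x', y, u)) x = 'D_(v, 0, 0) g (x, y, u).
Proof. by rewrite /derive /= slice1. Qed.

Lemma derive_partial2 x y u (v : 'cV[R]_n) :
  'D_v (fun y' => g (x, y', u)) y = 'D_(0, v, 0) g (x, y, u).
Proof. by rewrite /derive /= slice2. Qed.

Lemma is_derive_partial3 x y u (v : 'cV[R]_r) : differentiable g (x, y, u) ->
  is_derive u v (fun u' => g (x, y, u')) ('d g (x, y, u) (0, 0, v)).
Proof.
move=> dg; split; last by rewrite -deriveE// /derive /= slice3.
by have := @diff_derivable _ _ _ g _ (0, 0, v) dg; rewrite /derivable /= slice3.
Qed.

End Partial.

(** The part of (A1) and (A2) on which the analysis rests, over arbitrary normed spaces so that it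
    covers vector coefficients as well as their coordinates. *)
Definition C1_lipschitz {R : realType} {V W : normedModType R} (g : V -> W) :=
  [/\ exists L : R, forall a b, `|g a - g b| <= L * `|a - b|,
      forall z, differentiable g z &
      forall v, continuous (fun z => 'd g z v)].

Lemma C1_lipschitz_ex {R : realType} {V W : normedModType R} (g : V -> W) :
  C1_lipschitz g -> exists2 L : R, 0 <= L & forall a b, `|g a - g b| <= L * `|a - b|.
Proof.
move=> [[L gL] _ _]; exists `|L| => // a b; rewrite (le_trans (gL a b))//.
by rewrite ler_wpM2r// ler_norm.
Qed.

Lemma C1_lipschitz_continuous {R : realType} {V W : normedModType R} (g : V -> W) :
  C1_lipschitz g -> continuous g.
Proof. by move=> [_ dg _] z; exact: differentiable_continuous. Qed.

Lemma C1_lipschitz_coord {R : realType} {V : normedModType R} {p : nat}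
    (g : V -> 'cV[R]_p) i :
  C1_lipschitz g -> C1_lipschitz ((fun z => g z i ord0) : V -> R^o).
Proof.
move=> [[L gL] dg cg].
have dgi z := coord_is_diff i (dg z).
split.
- exists L => a b; apply: le_trans (gL a b).
  rewrite [leRHS]mx_normrE; apply: le_trans (le_bigmax _ _ (i, ord0)).
  by rewrite /= !mxE.
- by move=> z; exact: ex_diff.
- move=> v; rewrite (_ : (fun z => _) = (fun z => 'd g z v i ord0)).
    move=> z; apply: (@cvg_comp _ _ _ (fun z => 'd g z v) (fun M => M i ord0) _
      (nbhs ('d g z v))); first exact: cg.
    exact: coord_continuous.
  by apply/funext => z; rewrite diff_val.
Qed.

Lemma norm_cV_le_sum {R : realType} {n : nat} (x : 'cV[R]_n) :
  `|x| <= \sum_i `|x i ord0|.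
Proof.
rewrite [leLHS]mx_normrE; apply: bigmax_le; first exact: sumr_ge0.
move=> [i j] _; rewrite ord1 /= (bigD1 i)//= lerDl; exact: sumr_ge0.
Qed.

Lemma coord_le_norm {R : realType} {n : nat} (x : 'cV[R]_n) i :
  `|x i ord0| <= `|x|.
Proof.
by rewrite [leRHS]mx_normrE; exact: (le_bigmax _ (fun ij => `|x ij.1 ij.2|) (i, ord0)).
Qed.

Section TripleDecomposition.
Context {R : realType} {n r : nat} {W : lmodType R}.

Lemma cV_sum_delta {k} (a : 'cV[R]_k) : a = \sum_i a i ord0 *: delta_mx i ord0.
Proof.
rewrite {1}[a]matrix_sum_delta; apply: eq_bigr => i _.
by rewrite big_ord1.
Qed.

Lemma linear_sum_delta {k} (D : 'cV[R]_k -> W) a : linear D ->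
  D a = \sum_i a i ord0 *: D (delta_mx i ord0).
Proof.
move=> linD; pose D' : {linear 'cV[R]_k -> W} :=
  HB.pack D (GRing.isLinear.Build _ _ _ _ D linD).
rewrite {1}(cV_sum_delta a) -[D]/(D' : _ -> _) linear_sum.
by apply: eq_bigr => i _; rewrite linearZ.
Qed.

(** Separates the coefficients of a random differential, which are bounded, from its random
    direction, which is only integrable. *)
Lemma linear_triple
    (D : {linear ('cV[R]_n * 'cV[R]_n * 'cV[R]_r)%type -> W}) a b c :
  D (a, b, c) = \sum_i a i ord0 *: D (delta_mx i ord0, 0, 0) +
    \sum_i b i ord0 *: D (0, delta_mx i ord0, 0) +
    \sum_i c i ord0 *: D (0, 0, delta_mx i ord0).
Proof.
have -> : (a, b, c) = (a, 0, 0) + (0, b, 0) + (0, 0, c).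
  by congr (_, _, _); rewrite /= ?(addr0, add0r).
rewrite !linearD; congr (_ + _ + _).
- apply: (@linear_sum_delta _ (fun a => D (a, 0, 0))) => k x y.
  by rewrite -linearP; congr (D (_, _, _)); rewrite /= scaler0 addr0.
- apply: (@linear_sum_delta _ (fun a => D (0, a, 0))) => k x y.
  by rewrite -linearP; congr (D (_, _, _)); rewrite /= scaler0 addr0.
- apply: (@linear_sum_delta _ (fun a => D (0, 0, a))) => k x y.
  by rewrite -linearP; congr (D (_, _, _)); rewrite /= scaler0 addr0.
Qed.

End TripleDecomposition.

(** * Adapted processes *)

Section AdaptedClasses.
Context {disp : measure_display} {Omega : measurableType disp} {R : realType}.
Variables (P : probability Omega R).
Implicit Types (F : set (set Omega)) (X Y : Omega -> R).

(** The two classes paired by duality: states, controls and perturbations are [adapted_L1];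
    derivatives of coefficients and adjoint variables are [adapted_bd]. A product of one of each is
    again [adapted_L1]. *)
Definition adapted_L1 F X := measurable_wrt F X /\ integrable_rv P X.

Definition adapted_bd F X :=
  measurable_wrt F X /\ exists C : R, {ae P, forall w, `|X w| <= C}.

Lemma adapted_L1_sub F F' X : F `<=` F' -> adapted_L1 F X -> adapted_L1 F' X.
Proof. by move=> FF' [mX iX]; split => //; exact: measurable_wrt_sub mX. Qed.

Variable G : set (set Omega).
Hypothesis GM : <<s G >> `<=` measurable.
Let F : set (set Omega) := <<s G >>.

Lemma adapted_L1_cst (c : R) : adapted_L1 F (fun=> c).
Proof. by split; [exact: measurable_wrt_cst|exact: integrable_rv_cst]. Qed.

Lemma adapted_L1D X Y : adapted_L1 F X -> adapted_L1 F Y ->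
  adapted_L1 F (fun w => X w + Y w).
Proof.
by move=> [mX iX] [mY iY]; split; [exact: measurable_wrtD|exact: integrable_rvD].
Qed.

Lemma adapted_L1B X Y : adapted_L1 F X -> adapted_L1 F Y ->
  adapted_L1 F (fun w => X w - Y w).
Proof.
by move=> [mX iX] [mY iY]; split; [exact: measurable_wrtB|exact: integrable_rvB].
Qed.

Lemma adapted_L1Z (c : R) X : adapted_L1 F X -> adapted_L1 F (fun w => c * X w).
Proof.
by move=> [mX iX]; split; [exact: measurable_wrtZ|exact: integrable_rvZ].
Qed.

Lemma adapted_L1_sum (I : Type) (s : seq I) (X : I -> Omega -> R) :
  (forall i, adapted_L1 F (X i)) -> adapted_L1 F (fun w => \sum_(i <- s) X i w).
Proof.
move=> iX; split; first by apply: measurable_wrt_sum => i; case: (iX i).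
by apply: integrable_rv_sum => i; case: (iX i).
Qed.

Lemma adapted_L1_norm X : adapted_L1 F X -> adapted_L1 F (fun w => `|X w|).
Proof.
move=> [mX iX]; split; first exact: measurable_wrt_norm.
exact: integrable_rv_norm.
Qed.

Lemma adapted_bd_L1 X : adapted_bd F X -> adapted_L1 F X.
Proof.
move=> [mX [C XC]]; split => //.
apply: integrable_rv_ae_le (integrable_rv_cst P C) XC.
exact: measurable_wrt_measurable_fun mX.
Qed.

Lemma adapted_bd_cst (c : R) : adapted_bd F (fun=> c).
Proof.
by split; [exact: measurable_wrt_cst|exists `|c|; exact: aeW].
Qed.

Lemma adapted_bdD X Y : adapted_bd F X -> adapted_bd F Y ->
  adapted_bd F (fun w => X w + Y w).
Proof.
move=> [mX [C XC]] [mY [D YD]]; split; first exact: measurable_wrtD.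
exists (C + D); apply: filterS2 XC YD => w XC YD.
by rewrite (le_trans (ler_normD _ _))// lerD.
Qed.

Lemma adapted_bdM X Y : adapted_bd F X -> adapted_bd F Y ->
  adapted_bd F (fun w => X w * Y w).
Proof.
move=> [mX [C XC]] [mY [D YD]]; split; first exact: measurable_wrtM.
exists (C * D); apply: filterS2 XC YD => w XC YD.
by rewrite normrM ler_pM.
Qed.

Lemma adapted_bdZ (c : R) X : adapted_bd F X -> adapted_bd F (fun w => c * X w).
Proof. exact/adapted_bdM/adapted_bd_cst. Qed.

Lemma adapted_bdB X Y : adapted_bd F X -> adapted_bd F Y ->
  adapted_bd F (fun w => X w - Y w).
Proof.
move=> bX bY; under eq_fun do rewrite -[- Y _]mulN1r.
by apply: adapted_bdD => //; exact: adapted_bdZ.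
Qed.

Lemma adapted_bd_sum (I : Type) (s : seq I) (X : I -> Omega -> R) :
  (forall i, adapted_bd F (X i)) -> adapted_bd F (fun w => \sum_(i <- s) X i w).
Proof.
move=> iX; elim: s => [|i s ih].
  under eq_fun do rewrite big_nil; exact: adapted_bd_cst.
under eq_fun do rewrite big_cons; exact: adapted_bdD.
Qed.

Lemma adapted_L1M X Y : adapted_bd F X -> adapted_L1 F Y ->
  adapted_L1 F (fun w => X w * Y w).
Proof.
move=> [mX bX] [mY iY]; split; first exact: measurable_wrtM.
by apply: integrable_rvM_bounded => //; exact: measurable_wrt_measurable_fun mX.
Qed.

(** Comparison with the constants [C] and [- C]; this is how E{p(t + h) | F_t} inherits the bound on
    p(t + h). *)
Lemma cond_expect_bounded X Y (C : R) :
  is_cond_expect P F X Y -> {ae P, forall w, `|X w| <= C} -> adapted_bd F Y.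
Proof.
move=> XY XC; have [_ _ mY _] := XY; split => //; exists C.
have h1 : {ae P, forall w, Y w <= C}.
  apply: (cond_expect_mono GM XY (is_cond_expect_cst P G C)).
  by apply: filterS XC => w /ler_normlP[].
have h2 : {ae P, forall w, - C <= Y w}.
  apply: (cond_expect_mono GM (is_cond_expect_cst P G (- C)) XY).
  by apply: filterS XC => w /ler_normlP[h _]; rewrite lerNl.
by apply: filterS2 h1 h2 => w h1 h2; rewrite ler_norml h2.
Qed.

End AdaptedClasses.

(** * Multiplication by a noise increment *)

Section Increments.
Context {disp : measure_display} {Omega : measurableType disp} {R : realType}.
Variables (P : probability Omega R) (G : set (set Omega)).
Hypothesis GM : <<s G >> `<=` measurable.
Let F : set (set Omega) := <<s G >>.
Variables (h : R) (w_ : Omega -> R).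
Hypothesis mw : measurable_fun setT w_.
Hypothesis w_square : is_cond_expect P F (fun w => w_ w ^+ 2) (cst h).

(** Expands [(|x| - 1)^2 >= 0]; it trades [|w|] for a quantity whose conditional expectation is
    known. *)
Let norm_le_sqr (x : R) : `|x| <= 2^-1 * (1 + x ^+ 2).
Proof.
rewrite -real_normK ?num_real//; have := sqr_ge0 (`|x| - 1); lra.
Qed.

Let half_square : is_cond_expect P F (fun w => 2^-1 * (1 + w_ w ^+ 2))
  (fun w => 2^-1 * (1 + h)).
Proof.
apply: is_cond_expectZ => //; apply: is_cond_expectD => //.
exact: is_cond_expect_cst.
Qed.

(** [X] need not be bounded. The product is dominated by [|X| (1 + w^2) / 2]; since the second
    factor has conditional expectation [(1 + h) / 2], integrability of the bound reduces to that of
    [|X|]. *)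
Lemma integrable_mul_increment X : adapted_L1 P F X ->
  integrable_rv P (fun w => w_ w * X w).
Proof.
move=> [mX iX].
have i1 : integrable_rv P (fun w => `|X w| * (2^-1 * (1 + w_ w ^+ 2))).
  apply: (pull_out_integrable GM _ _ _ half_square) => //.
  - exact: measurable_wrt_norm.
  - by move=> w; rewrite mulr_ge0// addr_ge0// sqr_ge0.
  - under eq_fun do rewrite mulrC; exact/integrable_rvZ/integrable_rv_norm.
apply: (integrable_rv_le _ i1).
  by apply: measurable_funM => //; exact: integrable_rv_measurable iX.
by move=> w; rewrite normrM mulrC ler_wpM2l.
Qed.

Lemma integrable_increment : integrable_rv P w_.
Proof.
have := integrable_mul_increment (adapted_L1_cst P G 1).
by under eq_fun do rewrite mulr1.
Qed.

(** Here [X] is bounded but need not be [F]-measurable, so it cannot be pulled out; [w X] is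
    compared with [C (1 + w^2) / 2] and its opposite. Applied to p(t + h), this bounds [q]. *)
Lemma cond_expect_increment_bounded X Y (C : R) :
  {ae P, forall w, `|X w| <= C} ->
  is_cond_expect P F (fun w => w_ w * X w) Y -> adapted_bd P F Y.
Proof.
move=> XC XY; have [iX iY mY _] := XY; split => //.
have C0 : {ae P, forall w, 0 <= C}.
  by apply: filterS XC => w; apply: le_trans.
exists (C * (2^-1 * (1 + h))).
have hC := is_cond_expectZ GM C half_square.
have hN := is_cond_expectZ GM (- C) half_square.
have wX : {ae P, forall w, `|w_ w * X w| <= C * (2^-1 * (1 + w_ w ^+ 2))}.
  by apply: filterS XC => w XC; rewrite normrM mulrC ler_pM.
have h1 : {ae P, forall w, Y w <= C * (2^-1 * (1 + h))}.
  apply: (cond_expect_mono GM XY hC).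
  by apply: filterS wX => w /ler_normlP[].
have h2 : {ae P, forall w, - C * (2^-1 * (1 + h)) <= Y w}.
  apply: (cond_expect_mono GM hN XY).
  by apply: filterS wX => w /ler_normlP[h1' _]; rewrite mulNr lerNl.
apply: filterS2 h1 h2 => w h1 h2; rewrite ler_norml h1 andbT.
by rewrite -mulNr.
Qed.

End Increments.

Lemma norm_triple_le {R : realType} {n r : nat}
    (z : 'cV[R]_n * 'cV[R]_n * 'cV[R]_r) :
  `|z| <= `|z.1.1| + `|z.1.2| + `|z.2|.
Proof.
rewrite !prod_normE !ge_max.
have := normr_ge0 z.1.1; have := normr_ge0 z.1.2; have := normr_ge0 z.2.
by move=> c0 b0 a0; rewrite -andbA; apply/and3P; split; lra.
Qed.

Definition adapted_L1_vec {disp : measure_display} {Omega : measurableType disp}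
  {R : realType} (P : probability Omega R) {n : nat} (F : set (set Omega))
  (X : Omega -> 'cV[R]_n) := forall i, adapted_L1 P F (fun w => X w i ord0).

Definition adapted_bd_vec {disp : measure_display} {Omega : measurableType disp}
  {R : realType} (P : probability Omega R) {n : nat} (F : set (set Omega))
  (X : Omega -> 'cV[R]_n) := forall i, adapted_bd P F (fun w => X w i ord0).

Section VectorProcesses.
Context {disp : measure_display} {Omega : measurableType disp} {R : realType}.
Variables (P : probability Omega R) (G : set (set Omega)).
Hypothesis GM : <<s G >> `<=` measurable.
Let F : set (set Omega) := <<s G >>.
Context {n : nat}.
Implicit Types X Y : Omega -> 'cV[R]_n.

Lemma adapted_L1_vec_cst (c : 'cV[R]_n) : adapted_L1_vec P F (fun=> c).
Proof. by move=> i; exact: adapted_L1_cst. Qed.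

Lemma adapted_L1_vecD X Y : adapted_L1_vec P F X -> adapted_L1_vec P F Y ->
  adapted_L1_vec P F (fun w => X w + Y w).
Proof.
move=> aX aY i; under eq_fun do rewrite mxE.
exact: adapted_L1D (aX i) (aY i).
Qed.

Lemma adapted_L1_vecB X Y : adapted_L1_vec P F X -> adapted_L1_vec P F Y ->
  adapted_L1_vec P F (fun w => X w - Y w).
Proof.
move=> aX aY i; under eq_fun do rewrite !mxE.
exact: adapted_L1B (aX i) (aY i).
Qed.

Lemma adapted_L1_vecZ (c : R) X : adapted_L1_vec P F X ->
  adapted_L1_vec P F (fun w => c *: X w).
Proof.
move=> aX i; under eq_fun do rewrite mxE; exact: adapted_L1Z (aX i).
Qed.

Lemma adapted_L1_vec_norm X : adapted_L1_vec P F X ->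
  adapted_L1 P F (fun w => `|X w|).
Proof.
move=> aX; have mN : measurable_wrt F (fun w => `|X w|).
  have mX i : measurable_wrt F (fun w => X w i ord0) by case: (aX i).
  (* The second vector of the pair is a dummy. *)
  apply: (@measurable_wrt_continuous _ _ _ _ n n (fun z => `|z.1|) X X) => // z.
  by apply: cvg_norm; exact: cvg_fst.
split => //.
have [_ iS] : adapted_L1 P F (fun w => \sum_i `|X w i ord0|).
  by apply: adapted_L1_sum => i; exact/adapted_L1_norm.
apply: (integrable_rv_le _ iS).
  exact: measurable_wrt_measurable_fun mN.
by move=> w; rewrite normr_id norm_cV_le_sum.
Qed.

Lemma adapted_L1_dot Q X : adapted_bd_vec P F Q -> adapted_L1_vec P F X ->
  adapted_L1 P F (fun w => dot (Q w) (X w)).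
Proof.
by move=> bQ aX; apply: adapted_L1_sum => i; exact: adapted_L1M (bQ i) (aX i).
Qed.

Lemma expect_vecE X i : expect_vec P X i ord0 = \int[P]_w X w i ord0.
Proof. by rewrite mxE unlock. Qed.

End VectorProcesses.

(** * Coefficients and their differentials along a state, its mean and a control *)

Section StateFunctions.
Context {disp : measure_display} {Omega : measurableType disp} {R : realType}.
Variables (P : probability Omega R) (G : set (set Omega)).
Hypothesis GM : <<s G >> `<=` measurable.
Let F : set (set Omega) := <<s G >>.
Context {n r : nat}.
Let Z3 : normedModType R := ('cV[R]_n * 'cV[R]_n * 'cV[R]_r)%type.
Variables (X : Omega -> 'cV[R]_n) (y : 'cV[R]_n) (U : Omega -> 'cV[R]_r).
Hypothesis aX : adapted_L1_vec P F X.
Hypothesis aU : adapted_L1_vec P F U.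
Let z w : Z3 := (X w, y, U w).

(** The mean [y] is deterministic, so the triple depends continuously on the pair [(X, U)]. *)
Lemma measurable_state_fun (g : Z3 -> R) : continuous g ->
  measurable_wrt F (fun w => g (z w)).
Proof.
move=> cg.
apply: (@measurable_wrt_continuous _ _ _ _ _ _ (fun p => g (p.1, y, p.2))).
- move=> p; have cp : (p'.1, y, p'.2) @[p' --> p] --> ((p.1, y, p.2) : Z3).
    have H1 : (p'.1, y) @[p' --> p] --> (p.1, y).
      by have H := cvg_pair (@cvg_fst _ _ (nbhs p.1) (nbhs p.2) _)
        (@cvg_cst _ y _ (nbhs p) _); apply: H.
    by have H := cvg_pair H1 (@cvg_snd _ _ (nbhs p.1) (nbhs p.2) _); apply: H.
  exact: (cvg_comp _ _ cp (cg (p.1, y, p.2))).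
- by move=> i; case: (aX i).
- by move=> i; case: (aU i).
Qed.

(** The Lipschitz condition gives at most linear growth around the origin. *)
Lemma adapted_L1_state (g : Z3 -> R^o) : C1_lipschitz g ->
  adapted_L1 P F (fun w => g (z w)).
Proof.
move=> Cg; have [L L0 gL] := C1_lipschitz_ex Cg.
have mg := measurable_state_fun (C1_lipschitz_continuous Cg).
split => //.
have [_ iB] : adapted_L1 P F (fun w => `|g 0| + L * (`|X w| + `|y| + `|U w|)).
  apply: adapted_L1D; first exact: adapted_L1_cst.
  apply: adapted_L1Z; apply: adapted_L1D; last exact: adapted_L1_vec_norm.
  by apply: adapted_L1D; [exact: adapted_L1_vec_norm|exact: adapted_L1_cst].
apply: (integrable_rv_le _ iB); first exact: measurable_wrt_measurable_fun mg.
move=> w; rewrite -[g (z w)](subrKC (g 0)) (le_trans (ler_normD _ _))//.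
rewrite lerD2l (le_trans (gL _ _))// ler_wpM2l// subr0.
exact: norm_triple_le.
Qed.

Lemma adapted_bd_diff (g : Z3 -> R^o) v : C1_lipschitz g ->
  adapted_bd P F (fun w => 'd g (z w) v).
Proof.
move=> [[L gL] dg cg]; split; first exact: (measurable_state_fun (cg v)).
by exists (L * `|v|); apply: aeW => w; exact: diff_le_lipschitz.
Qed.

Lemma adapted_L1_diff (g : Z3 -> R^o) A b B : C1_lipschitz g ->
  adapted_L1_vec P F A -> adapted_L1_vec P F B ->
  adapted_L1 P F (fun w => 'd g (z w) (A w, b, B w)).
Proof.
move=> Cg aA aB; under eq_fun do rewrite linear_triple.
apply: adapted_L1D; first apply: adapted_L1D;
  apply: adapted_L1_sum => i; under eq_fun do rewrite [_ *: _]mulrC;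
  apply: adapted_L1M => //; try exact: adapted_bd_diff.
exact: adapted_L1_cst.
Qed.

End StateFunctions.

(** * First-order remainders under the expectation *)

Section Remainder.
Context {disp : measure_display} {Omega : measurableType disp} {R : realType}.
Variables (P : probability Omega R) (G : set (set Omega)).
Hypothesis GM : <<s G >> `<=` measurable.
Let F : set (set Omega) := <<s G >>.
Context {n r : nat}.
Let Z3 : normedModType R := ('cV[R]_n * 'cV[R]_n * 'cV[R]_r)%type.
Variables (X : Omega -> 'cV[R]_n) (y : 'cV[R]_n) (U : Omega -> 'cV[R]_r).
Hypothesis aX : adapted_L1_vec P F X.
Hypothesis aU : adapted_L1_vec P F U.
Let z w : Z3 := (X w, y, U w).

Lemma adapted_L1_remainder (g : Z3 -> R^o) A b B : C1_lipschitz g ->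
  adapted_L1_vec P F A -> adapted_L1_vec P F B ->
  adapted_L1 P F (fun w => g (z w + (A w, b, B w)) - g (z w)
     - 'd g (z w) (A w, b, B w)).
Proof.
move=> Cg aA aB; apply: adapted_L1B; last exact: adapted_L1_diff.
apply: adapted_L1B; last exact: adapted_L1_state.
exact: (adapted_L1_state GM (y + b) (adapted_L1_vecD aX aA)
  (adapted_L1_vecD aU aB) Cg).
Qed.

(** The weight [c] stands for a component of the conditional adjoint or of [q], or for 1; the factor
    [i + 1] is division by eps. *)
Lemma remainder_cvg0 (g : Z3 -> R^o) (c : Omega -> R) (D : Omega -> R)
    (A : nat -> Omega -> 'cV[R]_n) (b : nat -> 'cV[R]_n)
    (B : nat -> Omega -> 'cV[R]_r) :
  C1_lipschitz g -> adapted_bd P F c -> integrable_rv P D ->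
  (forall i, adapted_L1_vec P F (A i)) -> (forall i, adapted_L1_vec P F (B i)) ->
  (forall i w, i.+1%:R * `|(A i w, b i, B i w) : Z3| <= D w) ->
  (i.+1%:R * \int[P]_w (c w * (g (z w + (A i w, b i, B i w)) - g (z w)
     - 'd g (z w) (A i w, b i, B i w)))) @[i --> \oo] --> (0 : R).
Proof.
move=> Cg bc iD aA aB ABD.
have [L L0 gL] := C1_lipschitz_ex Cg; have [_ dg _] := Cg.
have [mc [C cC]] := bc.
have aR i : adapted_L1 P F (fun w => c w * (g (z w + (A i w, b i, B i w)) - g (z w)
     - 'd g (z w) (A i w, b i, B i w))).
  apply: adapted_L1M => //; exact: adapted_L1_remainder.
under eq_cvg => i do rewrite -RintegralZl ?(proj2 (aR i))//.
pose X_ i w := i.+1%:R * (c w * (g (z w + (A i w, b i, B i w)) - g (z w)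
     - 'd g (z w) (A i w, b i, B i w))).
suff : \int[P]_w X_ i w @[i --> \oo] --> \int[P]_w cst 0 w.
  by rewrite Rintegral_cstT.
(* [C] bounds the weight almost surely, and [2 L D] bounds [i + 1] times the remainder for all [i]
   at once. *)
apply: (@Rintegral_dominated _ _ _ P X_ (cst 0) (fun w => C * (2 * L * D w))).
- move=> i; apply: integrable_rv_measurable; apply: integrable_rvZ.
  exact: proj2 (aR i).
- exact: measurable_cst.
- move=> w; rewrite -[cst 0 w](mulr0 (c w)) (_ : X_ ^~ w = fun i => c w *
      (i.+1%:R *: (g (z w + (A i w, b i, B i w)) - g (z w)
     - 'd g (z w) (A i w, b i, B i w)) : R)).
    apply: cvgM; first exact: cvg_cst.
    exact: (diff_remainder_cvg0 (dg (z w)) (fun i => ABD i w)).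
  by apply/funext => i; rewrite /X_ mulrCA.
- exact/integrable_rvZ/integrable_rvZ.
- apply: filterS cC => w cC i; rewrite /X_.
  rewrite mulrCA normrM; apply: ler_pM => //.
  rewrite normrM ger0_norm// (le_trans (ler_wpM2l _ (diff_remainder_le _ gL (dg _))))//.
  by rewrite mulrCA ler_wpM2l// mulr_ge0.
Qed.

End Remainder.

Section Dot.
Context {R : realType} {n : nat}.
Implicit Types a b c : 'cV[R]_n.

Lemma dotC a b : dot a b = dot b a.
Proof. by apply: eq_bigr => i _; rewrite mulrC. Qed.

Lemma dotDr a b c : dot a (b + c) = dot a b + dot a c.
Proof. by rewrite -big_split; apply: eq_bigr => i _; rewrite mxE mulrDr. Qed.

Lemma dotZr k a b : dot a (k *: b) = k * dot a b.
Proof. by rewrite big_distrr; apply: eq_bigr => i _; rewrite mxE mulrCA. Qed.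

Lemma dotNr a b : dot a (- b) = - dot a b.
Proof. by rewrite -scaleN1r dotZr mulN1r. Qed.

Lemma dotBr a b c : dot a (b - c) = dot a b - dot a c.
Proof. by rewrite dotDr dotNr. Qed.

Lemma dotDl a b c : dot (a + b) c = dot a c + dot b c.
Proof. by rewrite dotC dotDr ![dot c _]dotC. Qed.

Lemma dotNl a b : dot (- a) b = - dot a b.
Proof. by rewrite dotC dotNr dotC. Qed.

Lemma dot_sumr (I : Type) (s : seq I) a (b : I -> 'cV[R]_n) :
  dot a (\sum_(i <- s) b i) = \sum_(i <- s) dot a (b i).
Proof.
elim: s => [|i s ih]; last by rewrite !big_cons dotDr ih.
by rewrite !big_nil -(scale0r 0) dotZr mul0r.
Qed.

End Dot.

Section VectorStateFunctions.
Context {disp : measure_display} {Omega : measurableType disp} {R : realType}.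
Variables (P : probability Omega R) (G : set (set Omega)).
Hypothesis GM : <<s G >> `<=` measurable.
Let F : set (set Omega) := <<s G >>.
Context {n r p : nat}.
Let Z3 : normedModType R := ('cV[R]_n * 'cV[R]_n * 'cV[R]_r)%type.
Variables (X : Omega -> 'cV[R]_n) (y : 'cV[R]_n) (U : Omega -> 'cV[R]_r).
Hypothesis aX : adapted_L1_vec P F X.
Hypothesis aU : adapted_L1_vec P F U.
Let z w : Z3 := (X w, y, U w).
Variable g : Z3 -> 'cV[R]_p.
Hypothesis Cg : C1_lipschitz g.

Lemma diff_coord a v i : 'd g a v i ord0 =
  'd ((fun x => g x i ord0) : Z3 -> R^o) a v.
Proof.
by have [_ dg _] := Cg; have H := coord_is_diff i (dg a); rewrite diff_val.
Qed.

Lemma adapted_L1_vec_state : adapted_L1_vec P F (fun w => g (z w)).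
Proof. by move=> i; exact: (adapted_L1_state GM y aX aU (C1_lipschitz_coord i Cg)). Qed.

Lemma adapted_bd_vec_diff v : adapted_bd_vec P F (fun w => 'd g (z w) v).
Proof.
move=> i; under eq_fun do rewrite diff_coord.
exact: (adapted_bd_diff y aX aU v (C1_lipschitz_coord i Cg)).
Qed.

Lemma adapted_L1_vec_diff A b B :
  adapted_L1_vec P F A -> adapted_L1_vec P F B ->
  adapted_L1_vec P F (fun w => 'd g (z w) (A w, b, B w)).
Proof.
move=> aA aB i; under eq_fun do rewrite diff_coord.
exact: (adapted_L1_diff GM y aX aU b (C1_lipschitz_coord i Cg)).
Qed.

End VectorStateFunctions.

(** * Random linear functionals and the vectors representing them *)

Section RandomFunctional.
Context {disp : measure_display} {Omega : measurableType disp} {R : realType}.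
Variables (P : probability Omega R) (G : set (set Omega)).
Hypothesis GM : <<s G >> `<=` measurable.
Let F : set (set Omega) := <<s G >>.
Context {n r : nat}.
Let Z3 : normedModType R := ('cV[R]_n * 'cV[R]_n * 'cV[R]_r)%type.
Variable D : Omega -> Z3 -> R.
Hypothesis D_linear : forall w, linear (D w : Z3 -> R^o).
Hypothesis D_bd : forall v, adapted_bd P F (D ^~ v).

Let D_triple w a b c : D w (a, b, c) =
    \sum_i a i ord0 * D w (delta_mx i ord0, 0, 0) +
    \sum_i b i ord0 * D w (0, delta_mx i ord0, 0) +
    \sum_i c i ord0 * D w (0, 0, delta_mx i ord0).
Proof.
pose D' : {linear Z3 -> R^o} :=
  HB.pack (D w : Z3 -> R^o) (GRing.isLinear.Build _ _ _ _ _ (D_linear w)).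
exact: (linear_triple D' a b c).
Qed.

Lemma functional_adapted_L1 A b B :
  adapted_L1_vec P F A -> adapted_L1_vec P F B ->
  adapted_L1 P F (fun w => D w (A w, b, B w)).
Proof.
move=> aA aB; under eq_fun do rewrite D_triple.
apply: adapted_L1D; first apply: adapted_L1D;
  apply: adapted_L1_sum => i; under eq_fun do rewrite mulrC;
  apply: adapted_L1M => //; try exact: D_bd.
exact: adapted_L1_cst.
Qed.

(** The representing vectors in the [x] and [y] slots: for the differential of the Hamiltonian they
    are its partial gradients [H_x] and [H_y], for the terminal cost those of [phi]. *)
Definition functional_x w : 'cV[R]_n := \col_i D w (delta_mx i ord0, 0, 0).
Definition functional_y w : 'cV[R]_n := \col_i D w (0, delta_mx i ord0, 0).

Lemma functional_x_bd : adapted_bd_vec P F functional_x.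
Proof. by move=> i; under eq_fun do rewrite mxE; exact: D_bd. Qed.

Lemma functional_y_bd : adapted_bd_vec P F functional_y.
Proof. by move=> i; under eq_fun do rewrite mxE; exact: D_bd. Qed.

(** The origin of the expectations in the adjoint equation: the [y] direction is the constant [E A],
    so pairing it with [functional_y] has the same expectation as pairing the mean of [functional_y]
    with [A]. *)
Lemma Rintegral_functional A : adapted_L1_vec P F A ->
  \int[P]_w D w (A w, expect_vec P A, 0) =
  \int[P]_w dot (functional_x w) (A w) +
  \int[P]_w dot (expect_vec P functional_y) (A w).
Proof.
move=> aA.
have iA i : integrable_rv P (fun w => A w i ord0) by case: (aA i).
have iy i : integrable_rv P (fun w => functional_y w i ord0).
  by case: (adapted_bd_L1 GM (functional_y_bd i)).
have DE w : D w (A w, expect_vec P A, 0) = dot (functional_x w) (A w) +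
   \sum_i expect_vec P A i ord0 * functional_y w i ord0.
  rewrite D_triple [X in _ + X]big1 ?addr0; last by move=> i _; rewrite mxE mul0r.
  congr (_ + _); apply: eq_bigr => i _; last by congr (_ * _); rewrite mxE.
  by rewrite mulrC; congr (_ * _); rewrite mxE.
under eq_Rintegral do rewrite DE.
rewrite RintegralD//; last 2 first.
- exact: (proj2 (adapted_L1_dot GM functional_x_bd aA)).
- by apply: integrable_rv_sum => i; exact: integrable_rvZ.
congr (_ + _); rewrite !Rintegral_sum; last 2 first.
- by move=> i; exact: integrable_rvZ.
- by move=> i; exact: integrable_rvZ.
apply: eq_bigr => i _; rewrite !RintegralZl; [|by []|exact: iA|by []|exact: iy].
by rewrite !expect_vecE mulrC.
Qed.

End RandomFunctional.

Lemma cond_expectP {disp : measure_display} {Omega : measurableType disp}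
    {R : realType} (P : probability Omega R) (G : set (set Omega))
    (X : Omega -> R) : <<s G >> `<=` measurable -> integrable_rv P X ->
  is_cond_expect P <<s G >> X (cond_expect P <<s G >> X).
Proof.
move=> GM iX; have [Y XY] := is_cond_expect_exists GM iX.
exact: (@xgetPex _ (cst 0) [set Y | is_cond_expect P <<s G >> X Y] (ex_intro _ Y XY)).
Qed.

Lemma cvg0_sum {R : realType} (I : Type) (t : seq I) (u : I -> nat -> R) :
  (forall k, u k i @[i --> \oo] --> (0 : R)) ->
  (\sum_(k <- t) u k i) @[i --> \oo] --> (0 : R).
Proof.
move=> u0; elim: t => [|k t ih].
  by under eq_cvg do rewrite big_nil; exact: cvg_cst.
under eq_cvg do rewrite big_cons.
suff : (u k i + \sum_(j <- t) u j i) @[i --> \oo] --> (0 + 0 : R) by rewrite addr0.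
by apply: cvgD; [exact: u0|exact: ih].
Qed.

(** * Duality over one time step *)

Section OneStep.
Context {disp : measure_display} {Omega : measurableType disp} {R : realType}.
Variables (P : probability Omega R) (G G' : set (set Omega)).
Hypotheses (GM : <<s G >> `<=` measurable) (GM' : <<s G' >> `<=` measurable).
Let F : set (set Omega) := <<s G >>.
Context {n r m : nat}.
Let Z3 : normedModType R := ('cV[R]_n * 'cV[R]_n * 'cV[R]_r)%type.
Variables (h : R) (dw : 'I_m -> Omega -> R).
Hypothesis mdw : forall j, measurable_fun setT (dw j).
Hypothesis dw_square :
  forall j, is_cond_expect P F (fun w => dw j w ^+ 2) (cst h).
Variables (f : Z3 -> 'cV[R]_n) (s : 'I_m -> Z3 -> 'cV[R]_n) (l : Z3 -> R^o).
Hypotheses (Cf : C1_lipschitz f) (Cs : forall j, C1_lipschitz (s j))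
  (Cl : C1_lipschitz l).

(* [p'] plays the role of p(t + h), and [adjoint_step] below that of p(t). *)
Variable p' : Omega -> 'cV[R]_n.
Hypothesis p'_bd : adapted_bd_vec P <<s G' >> p'.

Let pF := cond_expect_vec P F p'.
Let q j := cond_expect_vec P F (fun w => dw j w *: p' w).

Lemma increment_mul_integrable j X : adapted_L1 P F X ->
  integrable_rv P (fun w => dw j w * X w).
Proof. exact: (integrable_mul_increment GM (mdw j) (dw_square j)). Qed.

Lemma pF_cond_expect i : is_cond_expect P F (fun w => p' w i ord0)
  (fun w => pF w i ord0).
Proof.
under [X in is_cond_expect _ _ _ X]eq_fun do rewrite mxE.
apply: cond_expectP => //.
by case: (adapted_bd_L1 GM' (p'_bd i)).
Qed.

Lemma increment_adjoint_integrable j i :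
  integrable_rv P (fun w => dw j w * p' w i ord0).
Proof.
have [m' bd'] := p'_bd i.
under eq_fun do rewrite mulrC; apply: integrable_rvM_bounded => //.
  exact: (integrable_increment GM (mdw j) (dw_square j)).
exact: measurable_wrt_measurable_fun m'.
Qed.

Lemma q_cond_expect j i : is_cond_expect P F (fun w => dw j w * p' w i ord0)
  (fun w => q j w i ord0).
Proof.
under [X in is_cond_expect _ _ _ X]eq_fun do rewrite mxE.
under [X in is_cond_expect _ _ _ (fun _ => cond_expect _ _ X _)]eq_fun
  do rewrite mxE.
apply: cond_expectP => //; exact: increment_adjoint_integrable.
Qed.

Lemma pF_bd : adapted_bd_vec P F pF.
Proof.
move=> i; have [_ [C p'C]] := p'_bd i.
exact: (cond_expect_bounded GM (pF_cond_expect i) p'C).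
Qed.

Lemma q_bd j : adapted_bd_vec P F (q j).
Proof.
move=> i; have [_ [C p'C]] := p'_bd i.
exact: (cond_expect_increment_bounded GM (dw_square j) p'C (q_cond_expect j i)).
Qed.

Lemma adjoint_dot_integrable X : adapted_L1_vec P F X ->
  forall i, integrable_rv P (fun w => p' w i ord0 * X w i ord0).
Proof.
move=> aX i; have [m' bd'] := p'_bd i.
apply: integrable_rvM_bounded bd'; first by case: (aX i).
exact: measurable_wrt_measurable_fun m'.
Qed.

(** The integrable factor [X] is the one pulled out; both products are integrable because [p'] and
    [pF] are bounded. *)
Lemma pF_dot X : adapted_L1_vec P F X ->
  \int[P]_w dot (p' w) (X w) = \int[P]_w dot (pF w) (X w).
Proof.
move=> aX; have ip := adjoint_dot_integrable aX.
have ipF i : integrable_rv P (fun w => pF w i ord0 * X w i ord0).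
  by case: (adapted_L1M GM (pF_bd i) (aX i)).
rewrite !Rintegral_sum//; apply: eq_bigr => i _.
under eq_Rintegral do rewrite mulrC.
under [RHS]eq_Rintegral do rewrite mulrC.
have [mX _] := aX i.
apply: (pull_out GM mX (pF_cond_expect i)).
- by under eq_fun do rewrite mulrC.
- by under eq_fun do rewrite mulrC.
Qed.

Lemma increment_dot_integrable j X : adapted_L1_vec P F X ->
  forall i, integrable_rv P (fun w => p' w i ord0 * (dw j w *: X w) i ord0).
Proof.
move=> aX i; have [m' bd'] := p'_bd i.
apply: integrable_rvM_bounded bd'; last exact: measurable_wrt_measurable_fun m'.
by under eq_fun do rewrite mxE; exact: increment_mul_integrable.
Qed.

(** As for [pF_dot], with [dw j w * p'] conditioned. Here integrability comes from first grouping
    the increment with [X], then multiplying by the bounded [p']. *)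
Lemma q_dot j X : adapted_L1_vec P F X ->
  \int[P]_w dot (p' w) (dw j w *: X w) = \int[P]_w dot (q j w) (X w).
Proof.
move=> aX; have ip := increment_dot_integrable j aX.
have iq i : integrable_rv P (fun w => q j w i ord0 * X w i ord0).
  by case: (adapted_L1M GM (q_bd j i) (aX i)).
rewrite !Rintegral_sum//; apply: eq_bigr => i _.
have E w : p' w i ord0 * (dw j w *: X w) i ord0 =
    X w i ord0 * (dw j w * p' w i ord0) by rewrite mxE; ring.
under eq_Rintegral do rewrite E.
under [RHS]eq_Rintegral do rewrite mulrC.
have [mX _] := aX i.
apply: (pull_out GM mX (q_cond_expect j i)).
- by under eq_fun do rewrite -E.
- by under eq_fun do rewrite mulrC.
Qed.

(** The Hamiltonian as a linear form in the values [a], [b], [c] of the drift, the diffusions and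
    the running cost, to be evaluated on increments, differentials and Taylor remainders alike. *)
Definition ham (w : Omega) (a : 'cV[R]_n) (b : 'I_m -> 'cV[R]_n) (c : R) : R :=
  dot (pF w) (h *: a) + \sum_(j < m) dot (q j w) (b j) - c.

Lemma adapted_L1_ham a b c : adapted_L1_vec P F a ->
  (forall j, adapted_L1_vec P F (b j)) -> adapted_L1 P F c ->
  adapted_L1 P F (fun w => ham w (a w) (fun j => b j w) (c w)).
Proof.
move=> aa ab ac; apply: adapted_L1B => //; apply: adapted_L1D.
  by apply: adapted_L1_dot => //; [exact: pF_bd|exact: adapted_L1_vecZ].
by apply: adapted_L1_sum => j; apply: adapted_L1_dot => //; exact: q_bd.
Qed.

Lemma adapted_bd_dot Q X : adapted_bd_vec P F Q -> adapted_bd_vec P F X ->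
  adapted_bd P F (fun w => dot (Q w) (X w : 'cV[R]_n)).
Proof.
by move=> bQ bX; apply: adapted_bd_sum => i; exact: adapted_bdM (bQ i) (bX i).
Qed.

Lemma adapted_bd_ham a b c : adapted_bd_vec P F a ->
  (forall j, adapted_bd_vec P F (b j)) -> adapted_bd P F c ->
  adapted_bd P F (fun w => ham w (a w) (fun j => b j w) (c w)).
Proof.
move=> aa ab ac; apply: adapted_bdB => //; apply: adapted_bdD.
  under eq_fun do rewrite dotZr.
  by apply: adapted_bdZ; apply: adapted_bd_dot => //; exact: pF_bd.
by apply: adapted_bd_sum => j; apply: adapted_bd_dot => //; exact: q_bd.
Qed.

Lemma hamB w a b c a' b' c' :
  ham w (a - a') (fun j => b j - b' j) (c - c') = ham w a b c - ham w a' b' c'.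
Proof.
rewrite /ham scalerBr dotBr.
under eq_bigr do rewrite dotBr.
by rewrite sumrB; ring.
Qed.

Lemma ham_linear w k a b c a' b' c' :
  ham w (k *: a + a') (fun j => k *: b j + b' j) (k * c + c') =
  k * ham w a b c + ham w a' b' c'.
Proof.
rewrite /ham !scalerDr scalerA mulrC -scalerA !dotDr dotZr.
under eq_bigr do rewrite dotDr dotZr.
by rewrite big_split -big_distrr /=; ring.
Qed.

Variables (X : Omega -> 'cV[R]_n) (y : 'cV[R]_n) (U : Omega -> 'cV[R]_r).
Hypothesis aX : adapted_L1_vec P F X.
Hypothesis aU : adapted_L1_vec P F U.
Let z w : Z3 := (X w, y, U w).

Definition dham (w : Omega) (v : Z3) : R :=
  ham w ('d f (z w) v) (fun j => 'd (s j) (z w) v) ('d l (z w) v).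

Lemma dham_linear w : linear (dham w : Z3 -> R^o).
Proof.
move=> k a b; rewrite /dham -[RHS]ham_linear; congr ham.
- exact: linearP.
- by apply/funext => j; exact: linearP.
- exact: linearP.
Qed.

Lemma dham_bd v : adapted_bd P F (dham ^~ v).
Proof.
have bf := adapted_bd_vec_diff y aX aU Cf v.
have bs j := adapted_bd_vec_diff y aX aU (Cs j) v.
exact: (adapted_bd_ham bf bs (adapted_bd_diff y aX aU v Cl)).
Qed.

(** Undoes the conditioning in the drift term: the adjoint equation has the expectation of
    [f_y^T p(t + h)] with p(t + h) itself. *)
Lemma Rintegral_dham v : \int[P]_w dham w v =
  h * \int[P]_w dot (p' w) ('d f (z w) v) +
  \sum_(j < m) \int[P]_w dot (q j w) ('d (s j) (z w) v) -
  \int[P]_w 'd l (z w) v.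
Proof.
have L1_vec p (g : Z3 -> 'cV[R]_p) (Cg : C1_lipschitz g) :
    adapted_L1_vec P F (fun w => 'd g (z w) v).
  by move=> i; exact: (adapted_bd_L1 GM (adapted_bd_vec_diff y aX aU Cg v i)).
have [_ il] := adapted_bd_L1 GM (adapted_bd_diff y aX aU v Cl).
have [_ ipf] := adapted_L1_dot GM pF_bd (L1_vec _ f Cf).
have iqs j : integrable_rv P (fun w => dot (q j w) ('d (s j) (z w) v)).
  by have [_ ?] := adapted_L1_dot GM (q_bd j) (L1_vec _ (s j) (Cs j)).
have iqss : integrable_rv P (fun w => \sum_j dot (q j w) ('d (s j) (z w) v)).
  exact: integrable_rv_sum.
rewrite /dham /ham; under eq_Rintegral do rewrite dotZr.
rewrite RintegralB//; last exact: (integrable_rvD (integrable_rvZ h ipf) iqss).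
rewrite RintegralD//; last exact: (integrable_rvZ h ipf).
congr (_ + _ - _); last exact: (Rintegral_sum _ iqs).
transitivity (h * \int[P]_w dot (pF w) ('d f (z w) v)).
  exact: (RintegralZl h measurableT ipf).
by congr (_ * _); exact: esym (pF_dot (L1_vec _ f Cf)).
Qed.

(** The adjoint equation in the compact form p(t) = E{p(t + h) | F_t} + H_x + E H_y. *)
Definition adjoint_step w := pF w + functional_x dham w
  + expect_vec P (functional_y dham).

Lemma adjoint_step_bd : adapted_bd_vec P F adjoint_step.
Proof.
move=> i; under eq_fun do rewrite 2!mxE; apply: adapted_bdD.
  apply: adapted_bdD; first exact: pF_bd.
  exact: (functional_x_bd dham_bd).
exact: adapted_bd_cst.
Qed.

Section Variation.
Variables (A : Omega -> 'cV[R]_n) (B : Omega -> 'cV[R]_r).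
Hypothesis aA : adapted_L1_vec P F A.
Hypothesis aB : adapted_L1_vec P F B.
Let dz w : Z3 := (A w, expect_vec P A, B w).

Let adapted_shift p (g : Z3 -> 'cV[R]_p) : C1_lipschitz g ->
  adapted_L1_vec P F (fun w => g (z w + dz w) - g (z w)).
Proof.
move=> Cg; apply: adapted_L1_vecB; last exact: (adapted_L1_vec_state GM y aX aU Cg).
exact: (adapted_L1_vec_state GM (y + expect_vec P A)
  (adapted_L1_vecD aX aA) (adapted_L1_vecD aU aB) Cg).
Qed.

Let adapted_shift_l : adapted_L1 P F (fun w => l (z w + dz w) - l (z w)).
Proof.
apply: adapted_L1B; last exact: (adapted_L1_state GM y aX aU Cl).
exact: (adapted_L1_state GM (y + expect_vec P A)
  (adapted_L1_vecD aX aA) (adapted_L1_vecD aU aB) Cl).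
Qed.

Definition ham_remainder w := ham w
  (f (z w + dz w) - f (z w) - 'd f (z w) (dz w))
  (fun j => s j (z w + dz w) - s j (z w) - 'd (s j) (z w) (dz w))
  (l (z w + dz w) - l (z w) - 'd l (z w) (dz w)).

Lemma adapted_L1_ham_remainder : adapted_L1 P F ham_remainder.
Proof.
have af := adapted_L1_vecB (adapted_shift Cf)
  (adapted_L1_vec_diff GM y aX aU Cf (expect_vec P A) aA aB).
have as_ j := adapted_L1_vecB (adapted_shift (Cs j))
  (adapted_L1_vec_diff GM y aX aU (Cs j) (expect_vec P A) aA aB).
have al := adapted_L1B adapted_shift_l
  (adapted_L1_diff GM y aX aU (expect_vec P A) Cl aA aB).
exact: (adapted_L1_ham af as_ al).
Qed.

(** An exact identity. Conditioning turns the left pairing into [pF] against [A] plus the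
    Hamiltonian form on the coefficient increments; [adjoint_step] is chosen so that subtracting its
    pairing removes [pF] and the derivatives in the state and mean directions. *)
Lemma duality_one_step :
  \int[P]_w dot (p' w) (A w + h *: (f (z w + dz w) - f (z w)) +
      \sum_(j < m) dw j w *: (s j (z w + dz w) - s j (z w))) -
    \int[P]_w dot (adjoint_step w) (A w) =
  \int[P]_w (l (z w + dz w) - l (z w)) + \int[P]_w ham_remainder w +
    \int[P]_w dham w (0, 0, B w).
Proof.
set Df := fun w => f (z w + dz w) - f (z w).
set Ds := fun j w => s j (z w + dz w) - s j (z w).
set Dl := fun w => l (z w + dz w) - l (z w).
have aDf : adapted_L1_vec P F Df by exact: (adapted_shift Cf).
have aDs j : adapted_L1_vec P F (Ds j) by exact: (adapted_shift (Cs j)).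
have ihf := adapted_L1_vecZ h aDf.
have ip' Y : adapted_L1_vec P F Y -> integrable_rv P (fun w => dot (p' w) (Y w)).
  by move=> aY; apply: integrable_rv_sum => i; exact: adjoint_dot_integrable.
have ipF Y : adapted_L1_vec P F Y -> integrable_rv P (fun w => dot (pF w) (Y w)).
  by move=> aY; case: (adapted_L1_dot GM pF_bd aY).
have iq j Y : adapted_L1_vec P F Y -> integrable_rv P (fun w => dot (q j w) (Y w)).
  by move=> aY; case: (adapted_L1_dot GM (q_bd j) aY).
have idw j : integrable_rv P (fun w => dot (p' w) (dw j w *: Ds j w)).
  by apply: integrable_rv_sum => i; exact: increment_dot_integrable.
have lhs1 : \int[P]_w dot (p' w) (A w + h *: Df w + \sum_(j < m) dw j w *: Ds j w) =
    \int[P]_w dot (pF w) (A w) + (\int[P]_w dot (pF w) (h *: Df w) +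
    \sum_(j < m) \int[P]_w dot (q j w) (Ds j w)).
  under eq_Rintegral do rewrite !dotDr dot_sumr.
  rewrite RintegralD//; last 2 first.
  - exact: (integrable_rvD (ip' _ aA) (ip' _ ihf)).
  - exact: (integrable_rv_sum _ idw).
  rewrite RintegralD//; [|exact: ip'..].
  rewrite Rintegral_sum// -addrA pF_dot// (pF_dot ihf); congr (_ + (_ + _)).
  by apply: eq_bigr => j _; rewrite q_dot.
have lhs2 : \int[P]_w dot (adjoint_step w) (A w) = \int[P]_w dot (pF w) (A w) +
    \int[P]_w dham w (A w, expect_vec P A, 0).
  rewrite (Rintegral_functional GM dham_linear dham_bd aA) addrA.
  rewrite /adjoint_step; under eq_Rintegral do rewrite !dotDl.
  have ifx : integrable_rv P (fun w => dot (functional_x dham w) (A w)).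
    by case: (adapted_L1_dot GM (functional_x_bd dham_bd) aA).
  rewrite RintegralD//; last 2 first.
  - exact: (integrable_rvD (ipF _ aA) ifx).
  - by apply: integrable_rv_sum => i; apply: integrable_rvZ; case: (aA i).
  by rewrite RintegralD//; exact: ipF.
rewrite lhs1 lhs2 opprD addrA (addrC (\int[P]_w dot (pF w) (A w))) addrK.
have a0 : adapted_L1_vec P F (fun=> 0 : 'cV[R]_n) by exact: adapted_L1_vec_cst.
have b0 : adapted_L1_vec P F (fun=> 0 : 'cV[R]_r) by exact: adapted_L1_vec_cst.
have iD1 : integrable_rv P (fun w => dham w (A w, expect_vec P A, 0)).
  by case: (functional_adapted_L1 GM dham_linear dham_bd (expect_vec P A) aA b0).
have iD2 : integrable_rv P (fun w => dham w (0, 0, B w)).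
  by case: (functional_adapted_L1 GM dham_linear dham_bd 0 a0 aB).
have iDl : integrable_rv P Dl by case: adapted_shift_l.
have ir : integrable_rv P ham_remainder by case: adapted_L1_ham_remainder.
have isq : integrable_rv P (fun w => \sum_(j < m) dot (q j w) (Ds j w)).
  by apply: integrable_rv_sum => j; exact: iq.
rewrite -Rintegral_sum; last by move=> j; exact: iq.
rewrite -RintegralD//; last exact: ipF.
rewrite -RintegralB//; last exact: (integrable_rvD (ipF _ ihf) isq).
rewrite -RintegralD// -RintegralD//; last exact: (integrable_rvD iDl ir).
apply: eq_Rintegral => w _.
(* The direction splits into its state part, matched by the adjoint step, and its control part; the
   factor 1 gives the sum the shape required by linearity. *)
have dzE : dz w = 1 *: (A w, expect_vec P A, 0) + (0, 0, B w).
  by rewrite scale1r; congr (_, _, _); rewrite /= ?addr0 ?add0r.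
have -> : ham_remainder w = ham w (Df w) (Ds ^~ w) (Dl w) - dham w (dz w).
  by rewrite -hamB.
rewrite -/(Dl w) dzE (dham_linear w) (scale1r (_ : R^o)) /ham.
ring.
Qed.

End Variation.

(** Splits the form into scalar integrals, each a bounded adapted weight times an integrable
    variable, as [remainder_cvg0] expects; hence the explicit weight 1. *)
Lemma Rintegral_ham a b c : adapted_L1_vec P F a ->
  (forall j, adapted_L1_vec P F (b j)) -> adapted_L1 P F c ->
  \int[P]_w ham w (a w) (fun j => b j w) (c w) =
  \sum_i \int[P]_w (h * pF w i ord0 * a w i ord0) +
  \sum_(j < m) \sum_i \int[P]_w (q j w i ord0 * b j w i ord0) -
  \int[P]_w (1 * c w).
Proof.
move=> aa ab ac.
have ia i : integrable_rv P (fun w => h * pF w i ord0 * a w i ord0).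
  by case: (adapted_L1M GM (adapted_bdZ h (pF_bd i)) (aa i)).
have ib j i : integrable_rv P (fun w => q j w i ord0 * b j w i ord0).
  by case: (adapted_L1M GM (q_bd j i) (ab j i)).
have ic : integrable_rv P (fun w => 1 * c w).
  by apply: integrable_rvZ; case: ac.
have isb j : integrable_rv P (fun w => \sum_i q j w i ord0 * b j w i ord0).
  by apply: integrable_rv_sum.
have isa : integrable_rv P (fun w => \sum_i h * pF w i ord0 * a w i ord0).
  by apply: integrable_rv_sum.
have issb : integrable_rv P (fun w => \sum_j \sum_i q j w i ord0 * b j w i ord0).
  by apply: integrable_rv_sum.
have E w : ham w (a w) (fun j => b j w) (c w) =
    \sum_i h * pF w i ord0 * a w i ord0 +
    \sum_j \sum_i q j w i ord0 * b j w i ord0 - 1 * c w.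
  rewrite /ham mul1r dotZr; congr (_ + _ - _).
  by rewrite /dot big_distrr; apply: eq_bigr => i _; rewrite /= mulrA.
under eq_Rintegral do rewrite E.
rewrite RintegralB//; last exact: (integrable_rvD isa issb).
rewrite RintegralD// Rintegral_sum//; congr (_ + _ - _).
by rewrite Rintegral_sum//; apply: eq_bigr => j _; rewrite Rintegral_sum.
Qed.

Lemma ham_remainder_cvg0 (D : Omega -> R) (A : nat -> Omega -> 'cV[R]_n)
    (B : nat -> Omega -> 'cV[R]_r) :
  integrable_rv P D ->
  (forall i, adapted_L1_vec P F (A i)) -> (forall i, adapted_L1_vec P F (B i)) ->
  (forall i w, i.+1%:R * `|(A i w, expect_vec P (A i), B i w) : Z3| <= D w) ->
  (i.+1%:R * \int[P]_w ham_remainder (A i) (B i) w) @[i --> \oo] --> (0 : R).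
Proof.
move=> iD aA aB ABD.
pose dz i w : Z3 := (A i w, expect_vec P (A i), B i w).
pose rm (g : Z3 -> R^o) i w := g (z w + dz i w) - g (z w) - 'd g (z w) (dz i w).
pose fc k : Z3 -> R^o := fun x => f x k ord0.
pose sc j k : Z3 -> R^o := fun x => s j x k ord0.
have Cfc k : C1_lipschitz (fc k) by exact: C1_lipschitz_coord k Cf.
have Csc j k : C1_lipschitz (sc j k) by exact: C1_lipschitz_coord k (Cs j).
have arm g i : C1_lipschitz g -> adapted_L1 P F (rm g i).
  by move=> Cg; exact: (adapted_L1_remainder GM y aX aU (expect_vec P (A i)) Cg (aA i) (aB i)).
have rm0 g c : C1_lipschitz g -> adapted_bd P F c ->
    (i.+1%:R * \int[P]_w (c w * rm g i w)) @[i --> \oo] --> (0 : R).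
  by move=> Cg bc; exact (@remainder_cvg0 _ _ _ P G GM _ _ X y U aX aU g c D A (fun i => expect_vec P (A i)) B Cg bc iD aA aB ABD).
pose u1 i := \sum_k (i.+1%:R * \int[P]_w (h * pF w k ord0 * rm (fc k) i w)).
pose u2 i := \sum_(j < m) \sum_k
  (i.+1%:R * \int[P]_w (q j w k ord0 * rm (sc j k) i w)).
pose u3 i := i.+1%:R * \int[P]_w (1 * rm l i w).
have E i : i.+1%:R * \int[P]_w ham_remainder (A i) (B i) w = u1 i + u2 i - u3 i.
  pose a w : 'cV[R]_n := \col_k rm (fc k) i w.
  pose b j w : 'cV[R]_n := \col_k rm (sc j k) i w.
  have aE w : f (z w + dz i w) - f (z w) - 'd f (z w) (dz i w) = a w.
    by apply/colP => k; rewrite [RHS]mxE !mxE (diff_coord Cf).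
  have bE j w : s j (z w + dz i w) - s j (z w) - 'd (s j) (z w) (dz i w) = b j w.
    by apply/colP => k; rewrite [RHS]mxE !mxE (diff_coord (Cs j)).
  have aa : adapted_L1_vec P F a.
    by move=> k; under eq_fun do rewrite mxE; exact: arm (Cfc k).
  have ab j : adapted_L1_vec P F (b j).
    by move=> k; under eq_fun do rewrite mxE; exact: arm (Csc j k).
  have -> : \int[P]_w ham_remainder (A i) (B i) w =
      \int[P]_w ham w (a w) (fun j => b j w) (rm l i w).
    apply: eq_Rintegral => w _; rewrite /ham_remainder aE; congr ham.
    by apply/funext => j; exact: bE.
  rewrite (Rintegral_ham aa ab (arm l i Cl)).
  rewrite mulrBr mulrDr !big_distrr; congr (_ + _ - _).
    apply: eq_bigr => k _; congr (_ * _); apply: eq_Rintegral => w _.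
    by congr (_ * _); rewrite mxE.
  apply: eq_bigr => j _; rewrite big_distrr; apply: eq_bigr => k _.
  congr (_ * _); apply: eq_Rintegral => w _.
  by congr (_ * _); rewrite mxE.
suff : u1 i + u2 i - u3 i @[i --> \oo] --> (0 + 0 - 0 : R).
  by rewrite subr0 addr0; under eq_cvg do rewrite -E.
apply: cvgB; first apply: cvgD.
- by apply: cvg0_sum => k; exact: (rm0 _ _ (Cfc k) (adapted_bdZ h (pF_bd k))).
- apply: cvg0_sum => j; apply: cvg0_sum => k; exact: (rm0 _ _ (Csc j k) (q_bd j k)).
- exact: (rm0 _ _ Cl (adapted_bd_cst P G 1)).
Qed.

End OneStep.

(** * Jacobians and gradients expressed through differentials *)

Section DefinitionLinks.
Context {R : realType} {n r : nat}.

Lemma C1_lipschitz_uncurry3 {V : normedModType R} L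
    (psi : 'cV[R]_n -> 'cV[R]_n -> 'cV[R]_r -> V) :
  lipschitz_bounded L psi -> continuously_differentiable psi ->
  C1_lipschitz (uncurry3 psi).
Proof.
(* The norm of a triple is a maximum, so the sum of three norms costs a factor 3; the absolute value
   covers an [L] of unknown sign. *)
move=> [psiL _] [dpsi cpsi]; split => //; exists (`|L| * 3) => a b.
have h1 : `|a.1.1 - b.1.1| <= `|a - b| by rewrite !prod_normE !le_max lexx.
have h2 : `|a.1.2 - b.1.2| <= `|a - b| by rewrite !prod_normE !le_max lexx orbT.
have h3 : `|a.2 - b.2| <= `|a - b| by rewrite !prod_normE !le_max lexx !orbT.
apply: le_trans (psiL _ _ _ _ _ _) _; rewrite -mulrA.
apply: (@le_trans _ _ (`|L| * (`|a.1.1 - b.1.1| + `|a.1.2 - b.1.2| + `|a.2 - b.2|))).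
  by rewrite ler_wpM2r ?ler_norm// !addr_ge0.
rewrite ler_wpM2l//; lra.
Qed.

(** Entry [i] of a transposed Jacobian applied to [a] pairs [a] with the derivative along the [i]-th
    basis vector. *)
Lemma jacobian_x_trmul p (psi : 'cV[R]_n -> 'cV[R]_n -> 'cV[R]_r -> 'cV[R]_p)
    x y u (a : 'cV[R]_p) i : differentiable (uncurry3 psi) (x, y, u) ->
  ((jacobian_mx (fun x' => psi x' y u) x)^T *m a) i ord0 =
  dot a ('d (uncurry3 psi) (x, y, u) (delta_mx i ord0, 0, 0)).
Proof.
move=> dpsi; rewrite mxE; apply: eq_bigr => k _; rewrite !mxE mulrC; congr (_ * _).
have H := coord_is_diff k dpsi.
rewrite (derive_partial1 ((fun z => uncurry3 psi z k ord0) : _ -> R^o)).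
by rewrite deriveE ?diff_val//; exact: ex_diff.
Qed.

Lemma jacobian_y_trmul p (psi : 'cV[R]_n -> 'cV[R]_n -> 'cV[R]_r -> 'cV[R]_p)
    x y u (a : 'cV[R]_p) i : differentiable (uncurry3 psi) (x, y, u) ->
  ((jacobian_mx (fun y' => psi x y' u) y)^T *m a) i ord0 =
  dot a ('d (uncurry3 psi) (x, y, u) (0, delta_mx i ord0, 0)).
Proof.
move=> dpsi; rewrite mxE; apply: eq_bigr => k _; rewrite !mxE mulrC; congr (_ * _).
have H := coord_is_diff k dpsi.
rewrite (derive_partial2 ((fun z => uncurry3 psi z k ord0) : _ -> R^o)).
by rewrite deriveE ?diff_val//; exact: ex_diff.
Qed.

Lemma gradient_x (psi : 'cV[R]_n -> 'cV[R]_n -> 'cV[R]_r -> R^o) x y u i :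
  differentiable (uncurry3 psi) (x, y, u) ->
  gradient (fun x' => psi x' y u) x i ord0 =
  'd (uncurry3 psi) (x, y, u) (delta_mx i ord0, 0, 0).
Proof.
by move=> dpsi; rewrite mxE (derive_partial1 (uncurry3 psi)) deriveE.
Qed.

Lemma gradient_y (psi : 'cV[R]_n -> 'cV[R]_n -> 'cV[R]_r -> R^o) x y u i :
  differentiable (uncurry3 psi) (x, y, u) ->
  gradient (fun y' => psi x y' u) y i ord0 =
  'd (uncurry3 psi) (x, y, u) (0, delta_mx i ord0, 0).
Proof.
by move=> dpsi; rewrite mxE (derive_partial2 (uncurry3 psi)) deriveE.
Qed.

Lemma is_derive_dot_u p (psi : 'cV[R]_n -> 'cV[R]_n -> 'cV[R]_r -> 'cV[R]_p)
    x y u (a : 'cV[R]_p) v : differentiable (uncurry3 psi) (x, y, u) ->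
  is_derive u v ((fun u' => dot a (psi x y u')) : _ -> R^o)
    (dot a ('d (uncurry3 psi) (x, y, u) (0, 0, v))).
Proof.
move=> dpsi; rewrite /dot.
have -> : ((fun u' => \sum_(i < p) a i ord0 * psi x y u' i ord0) : _ -> R^o) =
    \sum_(i < p) (a i ord0 \*: ((fun u' => psi x y u' i ord0) : _ -> R^o)).
  by apply/funext => u'; rewrite fct_sumE.
apply: is_derive_sum => i; apply: is_deriveZ.
have H := coord_is_diff i dpsi.
have dk : differentiable ((fun z => uncurry3 psi z i ord0) : _ -> R^o) (x, y, u).
  exact: ex_diff.
have := is_derive_partial3 v dk.
by rewrite diff_val.
Qed.

End DefinitionLinks.

(** * The filtration of the noise *)

Section Filtration.
Context {disp : measure_display} {Omega : measurableType disp} {R : realType}.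
Context {m : nat}.
Variable W : nat -> Omega -> 'cV[R]_m.

Lemma filtration_mono k k' : (k <= k')%N -> filtration W k `<=` filtration W k'.
Proof.
move=> kk'; apply: sub_sigma_algebra2 => A [i [j [B [/andP[i0 ik] mB ->]]]].
by exists i, j, B; split => //=; rewrite i0 (leq_trans ik).
Qed.

Variables (P : probability Omega R) (h : R) (N : nat).
Hypothesis W_noise : noise P h N W.

Lemma filtration_measurable k : (k <= N.+1)%N -> filtration W k `<=` measurable.
Proof.
move=> kN; apply: smallest_sub; first exact: sigma_algebra_measurable.
move=> A [i [j [B [/andP[_ ik] mB ->]]]].
exact: (noise_rv W_noise (leq_trans ik kN)).
Qed.

Lemma measurable_noise k j : measurable_wrt (filtration W k) (fun w => W k w j ord0).
Proof.
(* Index 0 has no generator, but [W 0] vanishes identically. *)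
case: k => [|k].
  under eq_fun do rewrite (noise_start W_noise) mxE.
  exact: measurable_wrt_cst.
move=> B mB; apply: sub_sigma_algebra.
by exists k.+1, j, B; split => //=; rewrite leqnn.
Qed.

Lemma measurable_increment k j :
  measurable_wrt (filtration W k.+1) (fun w => increment W k w j ord0).
Proof.
under eq_fun do rewrite !mxE; apply: measurable_wrtB; first exact: measurable_noise.
exact: (measurable_wrt_sub (@filtration_mono k k.+1 (leqnSn k))
  (@measurable_noise k j)).
Qed.

End Filtration.

(** Names the generators, so that [filtration W k] is convertible to the form [<<s G >>] in which
    conditional expectations are treated. *)
Definition filtration_gen {disp : measure_display} {Omega : measurableType disp}
    {R : realType} {m : nat} (W : nat -> Omega -> 'cV[R]_m) (k : nat) :
    set (set Omega) :=
  [set A | exists i j (B : set R),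
     [/\ (0 < i <= k)%N, measurable B & A = (fun w => W i w j ord0) @^-1` B]].

Lemma control_direction_linear {R : realType} {n r : nat} (c : R) (a b : 'cV[R]_r) :
  (0, 0, c *: a + b) = c *: (0, 0, a) + (0, 0, b) :> 'cV[R]_n * 'cV[R]_n * 'cV[R]_r.
Proof. by congr (_, _, _); rewrite /= scaler0 addr0. Qed.

Lemma sum_telescope0 {R : realType} (S : nat -> R) n : S 0%N = 0 ->
  S n = \sum_(k < n) (S k.+1 - S k).
Proof.
move=> S0; elim: n => [|n ih]; first by rewrite big_ord0.
by rewrite big_ord_recr /= -ih subrKC.
Qed.

(** * Square-integrable variables *)

Section SquareIntegrable.
Context {disp : measure_display} {Omega : measurableType disp} {R : realType}.
Variable P : probability Omega R.

Lemma Lfun2_sqr (X : Omega -> R) : measurable_fun setT X ->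
  integrable_rv P (fun w => X w ^+ 2) -> X \in Lfun P 2%:E.
Proof.
move=> mX iX; rewrite inE/=; apply/andP; split; rewrite inE//=.
rewrite /finite_norm unlock poweR_lty//.
move/integrableP : iX => [_]; apply: le_lt_trans.
rewrite le_eqVlt; apply/orP; left; apply/eqP; apply: eq_integral => w _ /=.
by rewrite normrX powR_mulrn.
Qed.

(** Squaring gives [Y^2 <= 2 X^2 + 2 C^2]. With [X] a component of the control and [C] that of
    [|v|], controls moved towards [v] stay square integrable. *)
Lemma Lfun2_le (Y X : Omega -> R) (C : R) : measurable_fun setT Y ->
  X \in Lfun P 2%:E -> (forall w, `|Y w| <= `|X w| + C) -> Y \in Lfun P 2%:E.
Proof.
move=> mY LX YX; apply: Lfun2_sqr => //.
have i1 : integrable_rv P (fun w => 2 * X w ^+ 2 + 2 * C ^+ 2).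
  apply: integrable_rvD; last exact: integrable_rv_cst.
  by apply: integrable_rvZ; exact: Lfun2_integrable_sqr.
apply: (integrable_rv_le _ i1); first exact: measurable_funX.
move=> w; rewrite ger0_norm ?sqr_ge0// -real_normK ?num_real//.
apply: (@le_trans _ _ ((`|X w| + C) ^+ 2)).
  by rewrite lerXn2r ?nnegrE// (le_trans _ (YX w)).
rewrite -(real_normK (num_real (X w))).
have := sqr_ge0 (`|X w| - C); lra.
Qed.

Lemma L2_vec_adapted_L1 n F (X : Omega -> 'cV[R]_n) :
  L2_vec P F X -> adapted_L1_vec P F X.
Proof.
move=> [mX LX] i; split; first exact: mX.
apply/Lfun1_integrable; apply: Lfun_subset12 (LX i).
by rewrite fin_num_measure.
Qed.

End SquareIntegrable.

Lemma convex_set_segment {R : realType} {E : lmodType R} (A : set E) (a b : E) (c : R) :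
  0 <= c -> c <= 1 -> convex_set A -> A a -> A b -> A (a + c *: (b - a)).
Proof.
move=> c0 c1 cA Aa Ab.
have := cA b a (Itv01 c0 c1) (mem_set Ab) (mem_set Aa).
move=> /set_mem; congr A.
rewrite -[LHS]/(c *: b + (1 - c) *: a).
by rewrite scalerBl scale1r scalerBr addrCA.
Qed.

(** * Adjoint process and first variation of the cost *)

Section Dynamics.
Context {disp : measure_display} {Omega : measurableType disp} {R : realType}.
Context {n r m : nat}.
Variables (P : probability Omega R) (pb : control_problem R n r m).
Variable W : nat -> Omega -> 'cV[R]_m.
Let Z3 : normedModType R := ('cV[R]_n * 'cV[R]_n * 'cV[R]_r)%type.
Let h := step pb.
Let N := horizon pb.
Hypothesis W_noise : noise P h N W.
Hypothesis h_ge0 : 0 <= h.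
Hypotheses (A1 : assumption_A1 pb) (A2 : assumption_A2 pb).

Definition drift_at k : Z3 -> 'cV[R]_n := uncurry3 (drift pb (grid pb k)).
Definition diffusion_at k j : Z3 -> 'cV[R]_n := uncurry3 (diffusion pb j (grid pb k)).
Definition running_at k : Z3 -> R^o :=
  uncurry3 (running_cost pb (grid pb k) : _ -> _ -> _ -> R^o).
Definition terminal_fun : Z3 -> R^o := uncurry3 (terminal_cost_xyu pb).
Definition increments k j w : R := increment W k w j ord0.

Let F k : set (set Omega) := <<s filtration_gen W k >>.

Lemma C1_drift k : (k <= N)%N -> C1_lipschitz (drift_at k).
Proof.
move=> kN; have [L _ [/(_ k kN)[Lf _ _] _]] := A1.
have [[/(_ k kN)[df _ _] _] _] := A2.
exact: C1_lipschitz_uncurry3 Lf df.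
Qed.

Lemma C1_diffusion k j : (k <= N)%N -> C1_lipschitz (diffusion_at k j).
Proof.
move=> kN; have [L _ [/(_ k kN)[_ Ls _] _]] := A1.
have [[/(_ k kN)[_ ds _] _] _] := A2.
exact: C1_lipschitz_uncurry3 (Ls j) (ds j).
Qed.

Lemma C1_running k : (k <= N)%N -> C1_lipschitz (running_at k).
Proof.
move=> kN; have [L _ [/(_ k kN)[_ _ Ll] _]] := A1.
have [[/(_ k kN)[_ _ dl] _] _] := A2.
exact: C1_lipschitz_uncurry3 Ll dl.
Qed.

Lemma C1_terminal : C1_lipschitz terminal_fun.
Proof.
have [L _ [_ Lphi]] := A1; have [[_ dphi] _] := A2.
exact: C1_lipschitz_uncurry3 Lphi dphi.
Qed.

Lemma F_mono k k' : (k <= k')%N -> F k `<=` F k'.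
Proof. exact: filtration_mono. Qed.

Lemma F_measurable k : (k <= N.+1)%N -> F k `<=` measurable.
Proof. exact: (filtration_measurable W_noise). Qed.

Lemma increments_wrt k j : measurable_wrt (F k.+1) (increments k j).
Proof. exact: (measurable_increment W_noise). Qed.

Lemma increments_measurable k j : (k <= N)%N -> measurable_fun setT (increments k j).
Proof.
move=> kN; exact: (measurable_wrt_measurable_fun (F_measurable (kN : (k.+1 <= N.+1)%N))
  (@increments_wrt k j)).
Qed.

Lemma increments_square k j : (k <= N)%N ->
  is_cond_expect P (F k) (fun w => increments k j w ^+ 2) (cst h).
Proof. exact: (noise_square W_noise). Qed.

(** The class in which variations are computed: being stable under sums and scaling, it also
    contains the perturbing directions, which are not themselves controls. *)
Definition admissible_L1 (u : nat -> Omega -> 'cV[R]_r) :=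
  forall k, (k <= N)%N -> adapted_L1_vec P (F k) (u k).

Definition state_args (u : nat -> Omega -> 'cV[R]_r) k w : Z3 :=
  (state P pb W u k w, expect_vec P (state P pb W u k), u k w).

Lemma stateS u k w : state P pb W u k.+1 w = state P pb W u k w +
  h *: drift_at k (state_args u k w) +
  \sum_(j < m) increments k j w *: diffusion_at k j (state_args u k w).
Proof. by []. Qed.

Lemma adapted_increment_mul k j X : (k <= N)%N -> adapted_L1 P (F k) X ->
  adapted_L1 P (F k.+1) (fun w => increments k j w * X w).
Proof.
move=> kN aX; split.
  apply: measurable_wrtM; first exact: increments_wrt.
  by have [mX _] := aX; exact: (measurable_wrt_sub (@F_mono k k.+1 (leqnSn k)) mX).
exact: (integrable_mul_increment (F_measurable (leqW kN))
  (increments_measurable j kN) (increments_square j kN) aX).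
Qed.

(** The coefficients grow at most linearly, and multiplication by the increment sends integrable
    [F k]-measurable variables to integrable [F k.+1]-measurable ones. *)
Lemma state_adapted u k : admissible_L1 u -> (k <= N.+1)%N ->
  adapted_L1_vec P (F k) (state P pb W u k).
Proof.
move=> au; elim: k => [_|k ih kN]; first exact: adapted_L1_vec_cst.
have aX := ih (ltnW kN); have aU := au k kN; have GM := F_measurable (ltnW kN).
move=> i; rewrite (_ : (fun w => _) = fun w => (state P pb W u k w +
  h *: drift_at k (state_args u k w)) i ord0 +
  \sum_(j < m) increments k j w * diffusion_at k j (state_args u k w) i ord0); last first.
  apply/funext => w; rewrite stateS [in LHS]mxE summxE; congr (_ + _).
  by apply: eq_bigr => j _; rewrite mxE.
apply: adapted_L1D.
  apply: (adapted_L1_sub (@F_mono k k.+1 (leqnSn k))).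
  have af := adapted_L1_vec_state GM (expect_vec P (state P pb W u k)) aX aU
    (C1_drift kN).
  exact: (adapted_L1_vecD aX (adapted_L1_vecZ h af)).
apply: adapted_L1_sum => j.
have as_ := adapted_L1_vec_state GM (expect_vec P (state P pb W u k)) aX aU
    (C1_diffusion j kN).
exact: (adapted_increment_mul j kN (as_ i)).
Qed.

Lemma norm_expect_vec_le p G (A : Omega -> 'cV[R]_p) (D : Omega -> R) :
  adapted_L1_vec P G A -> integrable_rv P D -> (forall w, `|A w| <= D w) ->
  `|expect_vec P A| <= \int[P]_w D w.
Proof.
move=> aA iD AD.
have D0 w : 0 <= D w by exact: le_trans (AD w).
rewrite [leLHS]mx_normrE; apply: bigmax_le; first exact: Rintegral_ge0.
move=> [i j] _; rewrite ord1 /= expect_vecE.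
have [_ iA] := aA i.
apply: le_trans (le_normr_Rintegral measurableT iA) _.
apply: le_Rintegral => //; first exact: (integrable_rv_norm iA).
by move=> w _; exact: le_trans (coord_le_norm _ _) (AD w).
Qed.

Lemma expect_vecB p G (A B : Omega -> 'cV[R]_p) :
  adapted_L1_vec P G A -> adapted_L1_vec P G B ->
  expect_vec P A - expect_vec P B = expect_vec P (fun w => A w - B w).
Proof.
move=> aA aB; apply/colP => i; rewrite [LHS]mxE [X in _ + X]mxE !expect_vecE.
have [_ iA] := aA i; have [_ iB] := aB i.
by rewrite -RintegralB//; apply: eq_Rintegral => w _; rewrite !mxE.
Qed.

(** * Perturbed controls and domination of the state increments *)

Section Perturbation.
Variables u du : nat -> Omega -> 'cV[R]_r.
Hypotheses (au : admissible_L1 u) (adu : admissible_L1 du).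

Definition perturb (i k : nat) (w : Omega) : 'cV[R]_r :=
  u k w + i.+1%:R^-1 *: du k w.

Lemma perturb_admissible i : admissible_L1 (perturb i).
Proof.
move=> k kN; exact: (adapted_L1_vecD (au kN) (adapted_L1_vecZ _ (adu kN))).
Qed.

Definition dstate i k w := state P pb W (perturb i) k w - state P pb W u k w.

Lemma dstate_adapted i k : (k <= N.+1)%N -> adapted_L1_vec P (F k) (dstate i k).
Proof.
move=> kN; exact: (adapted_L1_vecB (state_adapted (perturb_admissible i) kN)
  (state_adapted au kN)).
Qed.

Definition dargs i k w : Z3 :=
  (dstate i k w, expect_vec P (dstate i k), i.+1%:R^-1 *: du k w).

Lemma state_args_perturb i k w : (k <= N.+1)%N ->
  state_args (perturb i) k w = state_args u k w + dargs i k w.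
Proof.
move=> kN; congr (_, _, _); rewrite /=.
- by rewrite /dstate subrKC.
- rewrite -(expect_vecB (state_adapted (perturb_admissible i) kN)
    (state_adapted au kN)).
  by rewrite subrKC.
Qed.

Lemma dstateS i k w : (k <= N.+1)%N -> dstate i k.+1 w = dstate i k w +
  h *: (drift_at k (state_args u k w + dargs i k w) - drift_at k (state_args u k w)) +
  \sum_(j < m) increments k j w *: (diffusion_at k j (state_args u k w + dargs i k w)
      - diffusion_at k j (state_args u k w)).
Proof.
move=> kN; rewrite -(state_args_perturb i w kN) /dstate !stateS scalerBr.
under [in RHS]eq_bigr do rewrite scalerBr.
by rewrite sumrB !opprD [LHS]addrACA [X in X + _ = _]addrACA.
Qed.

Lemma expect_dstate_le i k D : (k <= N.+1)%N -> integrable_rv P D ->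
  (forall w, i.+1%:R * `|dstate i k w| <= D w) ->
  i.+1%:R * `|expect_vec P (dstate i k)| <= \int[P]_w D w.
Proof.
move=> kN iD dD; rewrite -ler_pdivlMl// -RintegralZl//.
apply: (norm_expect_vec_le (dstate_adapted i kN)); first exact: integrable_rvZ.
by move=> w; rewrite ler_pdivlMl.
Qed.

(** The three summands of the bound dominate the state, mean and control slots; in the last one
    [i + 1] cancels the size of the perturbation. *)
Lemma dargs_dominated k D : (k <= N)%N -> adapted_L1 P (F k) D ->
  (forall i w, i.+1%:R * `|dstate i k w| <= D w) ->
  exists D', [/\ adapted_L1 P (F k) D', forall w, 0 <= D' w &
    forall i w, i.+1%:R * `|dargs i k w| <= D' w].
Proof.
move=> kN aD dD; exists (fun w => D w + \int[P]_w D w + `|du k w|).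
have dargsD i w : i.+1%:R * `|dargs i k w| <= D w + \int[P]_w D w + `|du k w|.
  have i0 : (0 : R) < i.+1%:R by [].
  apply: le_trans (ler_wpM2l (ltW i0) (norm_triple_le _)) _.
  rewrite !mulrDr lerD//; last first.
    by rewrite /= normrZ normfV [X in X^-1]gtr0_norm// mulrA divff ?mul1r// gt_eqF.
  by rewrite lerD//=; apply: (expect_dstate_le (leqW kN)) => //; case: aD.
split => //; last first.
  by move=> w; apply: le_trans (dargsD 0%N w); rewrite mulr_ge0.
have GM := F_measurable (leqW kN).
apply: adapted_L1D; last exact: (adapted_L1_vec_norm GM (adu kN)).
by apply: adapted_L1D => //; exact: adapted_L1_cst.
Qed.

Lemma dstate_dominated k : (k <= N.+1)%N -> exists2 D, adapted_L1 P (F k) D &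
  forall i w, i.+1%:R * `|dstate i k w| <= D w.
Proof.
elim: k => [_|k ih kN].
  exists (fun=> 0); first exact: adapted_L1_cst.
  by move=> i w; rewrite /dstate /= subrr normr0 mulr0.
have [D aD dD] := ih (ltnW kN).
have [D' [aD' D'0 dD']] := dargs_dominated kN aD dD.
have [Lf Lf0 fL] := C1_lipschitz_ex (C1_drift kN).
have /choice[Ls sL] : forall j, exists L : R, 0 <= L /\
    forall a b, `|diffusion_at k j a - diffusion_at k j b| <= L * `|a - b|.
  by move=> j; have [L L0 sL] := C1_lipschitz_ex (C1_diffusion j kN); exists L.
(* One step of the recursion, by the Lipschitz constants of the drift and of each diffusion. The
   factor [D'] is [F k]-measurable, so its product with the increment is integrable. *)
exists (fun w => D w + h * (Lf * D' w) +
    \sum_(j < m) `|increments k j w| * (Ls j * D' w)).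
  apply: adapted_L1D.
    apply: (adapted_L1_sub (@F_mono k k.+1 (leqnSn k))).
    exact: (adapted_L1D aD (adapted_L1Z h (adapted_L1Z Lf aD'))).
  apply: adapted_L1_sum => j.
  have := adapted_L1_norm (adapted_increment_mul j kN (adapted_L1Z (Ls j) aD')).
  congr adapted_L1; apply/funext => w; rewrite normrM [X in _ * X]ger0_norm//.
  by rewrite mulr_ge0//; case: (sL j).
move=> i w; have i0 : (0 : R) <= i.+1%:R by [].
have dz : `|state_args u k w + dargs i k w - state_args u k w| = `|dargs i k w|.
  by rewrite addrC addKr.
rewrite (dstateS i w (leqW kN)); apply: le_trans (ler_wpM2l i0 (ler_normD _ _)) _.
rewrite mulrDr lerD//.
  apply: le_trans (ler_wpM2l i0 (ler_normD _ _)) _.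
  rewrite mulrDr lerD// normrZ ger0_norm// mulrCA ler_wpM2l//.
  apply: le_trans (ler_wpM2l i0 (fL _ _)) _.
  by rewrite dz mulrCA ler_wpM2l.
apply: le_trans (ler_wpM2l i0 (ler_norm_sum _ _ _)) _.
rewrite big_distrr; apply: ler_sum => j _; have [Lj0 jL] := sL j.
rewrite /= normrZ mulrCA ler_wpM2l//.
apply: le_trans (ler_wpM2l i0 (jL _ _)) _.
by rewrite dz mulrCA ler_wpM2l.
Qed.

End Perturbation.

(** * The adjoint process by backward recursion *)

Section Adjoint.
Variable u : nat -> Omega -> 'cV[R]_r.
Hypothesis au : admissible_L1 u.
Let x := state P pb W u.

(** The control slot, on which [phi] does not depend, is filled with 0. *)
Definition terminal_args w : Z3 := (x N.+1 w, expect_vec P (x N.+1), 0).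

Definition terminal_functional w v : R := 'd terminal_fun (terminal_args w) v.

Definition adjoint_terminal w : 'cV[R]_n :=
  - functional_x terminal_functional w
  - expect_vec P (functional_y terminal_functional).

(** Recursion on the number of steps back from the horizon: [adjoint_back i] is p(t_{N+1-i}), so its
    successor case for [i'] uses the coefficients at time [N - i']. *)
Fixpoint adjoint_back (i : nat) : Omega -> 'cV[R]_n :=
  if i is i'.+1 then
    let k := (N - i')%N in
    adjoint_step P (filtration_gen W k) h (increments k) (drift_at k)
      (diffusion_at k) (running_at k) (adjoint_back i')
      (x k) (expect_vec P (x k)) (u k)
  else adjoint_terminal.

Definition adjoint k := adjoint_back (N.+1 - k).

Lemma adjointE k : (k <= N)%N -> adjoint k =
  adjoint_step P (filtration_gen W k) h (increments k) (drift_at k)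
    (diffusion_at k) (running_at k) (adjoint k.+1)
    (x k) (expect_vec P (x k)) (u k).
Proof.
move=> kN.
have backS i : adjoint_back i.+1 =
  adjoint_step P (filtration_gen W (N - i)) h (increments (N - i))
    (drift_at (N - i)) (diffusion_at (N - i)) (running_at (N - i))
    (adjoint_back i) (x (N - i)) (expect_vec P (x (N - i))) (u (N - i)) by [].
by rewrite {1}/adjoint (subSn kN) backS (subKn kN) /adjoint subSS.
Qed.

Let xa k : (k <= N.+1)%N -> adapted_L1_vec P (F k) (x k).
Proof. exact: state_adapted. Qed.

Let z0 : adapted_L1_vec P (F N.+1) (fun=> 0 : 'cV[R]_r).
Proof. exact: adapted_L1_vec_cst. Qed.

Lemma terminal_functional_linear w : linear (terminal_functional w : Z3 -> R^o).
Proof. by move=> k a b; exact: linearP. Qed.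

Lemma terminal_functional_bd v : adapted_bd P (F N.+1) (terminal_functional ^~ v).
Proof.
exact: (adapted_bd_diff (expect_vec P (x N.+1)) (xa (leqnn _)) z0 v C1_terminal).
Qed.

Lemma adjoint_terminal_bd : adapted_bd_vec P (F N.+1) adjoint_terminal.
Proof.
move=> i; under eq_fun do rewrite 2!mxE -mulN1r [X in _ + X]mxE.
apply: adapted_bdB; last exact: adapted_bd_cst.
exact: (adapted_bdZ _ (functional_x_bd terminal_functional_bd i)).
Qed.

Lemma adjoint_bd k : (k <= N.+1)%N -> adapted_bd_vec P (F k) (adjoint k).
Proof.
have back i : (i <= N.+1)%N -> adapted_bd_vec P (F (N.+1 - i)) (adjoint_back i).
  elim: i => [_|i ih iN]; first by rewrite subn0; exact: adjoint_terminal_bd.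
  have kN : (N - i <= N)%N by exact: leq_subr.
  rewrite subSS /=.
  exact: (adjoint_step_bd (F_measurable (leqW kN)) (F_measurable (leq_subr i _))
    (fun j => increments_measurable j kN) (fun j => increments_square j kN)
    (C1_drift kN) (fun j => C1_diffusion j kN) (C1_running kN) (ih (ltnW iN))
    (expect_vec P (x (N - i))) (xa (leqW kN)) (au kN)).
by move=> kN; have := back (N.+1 - k)%N (leq_subr _ _); rewrite subKn.
Qed.

Definition hamiltonian_diff k : Omega -> Z3 -> R :=
  dham P (filtration_gen W k) h (increments k) (drift_at k) (diffusion_at k)
    (running_at k) (adjoint k.+1) (x k) (expect_vec P (x k)) (u k).

Lemma hamiltonian_diff_linear k w : linear (hamiltonian_diff k w : Z3 -> R^o).
Proof. exact: dham_linear. Qed.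

Lemma hamiltonian_diff_bd k v : (k <= N)%N ->
  adapted_bd P (F k) (hamiltonian_diff k ^~ v).
Proof.
move=> kN; exact: (dham_bd (F_measurable (leqW kN)) (F_measurable (kN : (k.+1 <= N.+1)%N))
    (fun j => increments_measurable j kN) (fun j => increments_square j kN)
    (C1_drift kN) (fun j => C1_diffusion j kN) (C1_running kN) (@adjoint_bd k.+1 kN)
    (expect_vec P (x k)) (xa (leqW kN)) (au kN) v).
Qed.

(** J as a real number, with the expectation inside the sum; [cost_total] identifies it with
    [cost]. *)
Definition total_cost (u' : nat -> Omega -> 'cV[R]_r) : R :=
  \int[P]_w terminal_fun (state P pb W u' N.+1 w, expect_vec P (state P pb W u' N.+1), 0) +
  \sum_(k < N.+1) \int[P]_w running_at k (state_args u' k w).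

(** * First variation of the cost *)

Section FirstVariation.
Variable du : nat -> Omega -> 'cV[R]_r.
Hypothesis adu : admissible_L1 du.

Let step_remainder i k := ham_remainder P (filtration_gen W k) h (increments k)
  (drift_at k) (diffusion_at k) (running_at k) (adjoint k.+1) (x k)
  (expect_vec P (x k)) (u k) (dstate u du i k) (fun w => i.+1%:R^-1 *: du k w).

Let aB i k : (k <= N)%N -> adapted_L1_vec P (F k) (fun w => i.+1%:R^-1 *: du k w).
Proof. by move=> kN; exact: (adapted_L1_vecZ _ (adu kN)). Qed.

Let control_term k := \int[P]_w hamiltonian_diff k w (0, 0, du k w).

Let control_scale i k : (k <= N)%N ->
  \int[P]_w hamiltonian_diff k w (0, 0, i.+1%:R^-1 *: du k w) =
  i.+1%:R^-1 * control_term k.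
Proof.
move=> kN.
have H := functional_adapted_L1 (F_measurable (leqW kN)) (@hamiltonian_diff_linear k)
  (fun v => hamiltonian_diff_bd v kN) 0 (adapted_L1_vec_cst P _ 0) (adu kN).
rewrite -RintegralZl//; last by case: H.
apply: eq_Rintegral => w _.
have -> : (0, 0, i.+1%:R^-1 *: du k w) = i.+1%:R^-1 *: (0, 0, du k w) + 0 :> Z3.
  by congr (_, _, _); rewrite /= ?scaler0 addr0.
rewrite hamiltonian_diff_linear -[RHS]addr0; congr (_ + _).
have /eqP := hamiltonian_diff_linear k w 1 0 0.
rewrite scaler0 addr0 (scale1r (_ : R^o)) -[eqbLHS]addr0.
by rewrite (inj_eq (addrI _)) eq_sym => /eqP.
Qed.

(** [duality_one_step] with the state increment as [A] and eps times [du] as [B]; by linearity the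
    control contribution is eps times a quantity independent of [i]. *)
Lemma duality_step i k : (k <= N)%N ->
  \int[P]_w dot (adjoint k.+1 w) (dstate u du i k.+1 w) -
    \int[P]_w dot (adjoint k w) (dstate u du i k w) =
  \int[P]_w running_at k (state_args (perturb u du i) k w) -
    \int[P]_w running_at k (state_args u k w) +
  \int[P]_w step_remainder i k w + i.+1%:R^-1 * control_term k.
Proof.
move=> kN; have kN1 := leqW kN.
have adx := dstate_adapted au adu i kN1.
have H := duality_one_step (F_measurable kN1) (F_measurable (kN : (k.+1 <= N.+1)%N))
  (fun j => increments_measurable j kN) (fun j => increments_square j kN)
  (C1_drift kN) (fun j => C1_diffusion j kN) (C1_running kN) (@adjoint_bd k.+1 kN)
  (expect_vec P (x k)) (xa kN1) (au kN) adx (aB i kN).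
rewrite -(control_scale i kN) (adjointE kN).
under [X in X - _ = _]eq_Rintegral do rewrite (dstateS au adu i _ kN1).
rewrite [LHS]H; congr (_ + _ + _).
rewrite -RintegralB//; last 2 first.
- have [_ iR] := adapted_L1_state (F_measurable kN1)
    (expect_vec P (state P pb W (perturb u du i) k))
    (state_adapted (perturb_admissible au adu i) kN1)
    (perturb_admissible au adu i kN) (C1_running kN).
  exact: iR.
- have [_ iR] := adapted_L1_state (F_measurable kN1) (expect_vec P (x k)) (xa kN1)
    (au kN) (C1_running kN).
  exact: iR.
by apply: eq_Rintegral => w _; rewrite (state_args_perturb au adu i w kN1).
Qed.

Let terminal_shift i w : Z3 :=
  (dstate u du i N.+1 w, expect_vec P (dstate u du i N.+1), 0).

Let terminal_remainder i w := terminal_fun (terminal_args w + terminal_shift i w)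
  - terminal_fun (terminal_args w)
  - 'd terminal_fun (terminal_args w) (terminal_shift i w).

Let FN := F_measurable (leqnn N.+1).

Let adN i := dstate_adapted au adu i (leqnn N.+1).

(** By the terminal condition the left side is minus the expected differential of [phi] along the
    shift, that is, minus the variation of the terminal cost up to a remainder. *)
Lemma duality_terminal i :
  \int[P]_w dot (adjoint N.+1 w) (dstate u du i N.+1 w) =
  \int[P]_w terminal_remainder i w -
  (\int[P]_w terminal_fun (state P pb W (perturb u du i) N.+1 w,
       expect_vec P (state P pb W (perturb u du i) N.+1), 0) -
   \int[P]_w terminal_fun (terminal_args w)).
Proof.
have ix := xa (leqnn N.+1).
have aD := functional_adapted_L1 FN terminal_functional_linear terminal_functional_bd
  (expect_vec P (dstate u du i N.+1)) (adN i) z0.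
have shiftE w : (state P pb W (perturb u du i) N.+1 w,
       expect_vec P (state P pb W (perturb u du i) N.+1), 0) =
    terminal_args w + terminal_shift i w.
  have E := congr1 fst (state_args_perturb au adu i w (leqnn N.+1)).
  rewrite -[LHS]/((state_args (perturb u du i) N.+1 w).1, 0) E.
  by congr (_, _); rewrite [RHS]addr0.
have aT : adapted_L1 P (F N.+1) (fun w => terminal_fun (terminal_args w)).
  exact: (adapted_L1_state FN (expect_vec P (x N.+1)) ix z0 C1_terminal).
have aT' : adapted_L1 P (F N.+1)
    (fun w => terminal_fun (terminal_args w + terminal_shift i w)).
  have := adapted_L1_state FN (expect_vec P (state P pb W (perturb u du i) N.+1))
    (state_adapted (perturb_admissible au adu i) (leqnn N.+1)) z0 C1_terminal.
  by congr adapted_L1; apply/funext => w; rewrite -shiftE.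
have [_ iT] := aT; have [_ iT'] := aT'; have [_ iD] := aD.
under [X in _ - (X - _)]eq_Rintegral do rewrite shiftE.
transitivity (- \int[P]_w terminal_functional w (terminal_shift i w)); last first.
  rewrite /terminal_remainder RintegralB//; last exact: (integrable_rvB iT' iT).
  by rewrite RintegralB//; ring.
rewrite (Rintegral_functional FN terminal_functional_linear terminal_functional_bd
  (adN i)).
have -> : adjoint N.+1 = adjoint_terminal by rewrite /adjoint subnn.
rewrite /adjoint_terminal; under eq_Rintegral do rewrite dotDl !dotNl.
have ifx : integrable_rv P
    (fun w => dot (functional_x terminal_functional w) (dstate u du i N.+1 w)).
  by case: (adapted_L1_dot FN (functional_x_bd terminal_functional_bd) (adN i)).
have ify : integrable_rv P (fun w => dot (expect_vec P
    (functional_y terminal_functional)) (dstate u du i N.+1 w)).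
  by apply: integrable_rv_sum => j; apply: integrable_rvZ; case: (adN i j).
have E w : - dot (functional_x terminal_functional w) (dstate u du i N.+1 w) -
    dot (expect_vec P (functional_y terminal_functional)) (dstate u du i N.+1 w) =
    -1 * (dot (functional_x terminal_functional w) (dstate u du i N.+1 w) +
    dot (expect_vec P (functional_y terminal_functional)) (dstate u du i N.+1 w)).
  by ring.
under eq_Rintegral do rewrite E.
rewrite RintegralZl//; last exact: (integrable_rvD ifx ify).
by rewrite RintegralD// mulN1r.
Qed.

(** Still exact, before any limit. The sign of the last sum is what makes minimality of the cost a
    maximum condition, to first order, on the Hamiltonian. *)
Lemma cost_variation i : total_cost (perturb u du i) - total_cost u =
  \int[P]_w terminal_remainder i w - \sum_(k < N.+1) \int[P]_w step_remainder i k w -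
  i.+1%:R^-1 * \sum_(k < N.+1) control_term k.
Proof.
have dx0 w : dstate u du i 0 w = 0 by rewrite /dstate subrr.
(* The telescoping quantity; it starts from 0 because both states have the same initial value. *)
pose S k := \int[P]_w dot (adjoint k w) (dstate u du i k w).
have S0 : S 0 = 0.
  rewrite -[RHS](Rintegral_cstT P); apply: eq_Rintegral => w _.
  by rewrite dx0 -(scale0r 0) dotZr mul0r.
have SN : S N.+1 = \sum_(k < N.+1) (S k.+1 - S k).
  exact: sum_telescope0.
have := duality_terminal i; rewrite -/(S N.+1) SN.
have -> : \sum_(k < N.+1) (S k.+1 - S k) = \sum_(k < N.+1)
    (\int[P]_w running_at k (state_args (perturb u du i) k w) -
    \int[P]_w running_at k (state_args u k w) + \int[P]_w step_remainder i k w +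
    i.+1%:R^-1 * control_term k).
  by apply: eq_bigr => k _; rewrite /S (duality_step i (ltn_ord k : (k <= N)%N)).
rewrite !big_split sumrN -big_distrr /= => E.
rewrite /total_cost -/(terminal_args _).
set A := \sum_(k < N.+1) \int[P]_w running_at k (state_args u k w) in E *.
set A' := \sum_(k < N.+1) \int[P]_w running_at k (state_args (perturb u du i) k w) in E *.
set B := \int[P]_w terminal_fun (terminal_args w) in E *.
rewrite -[X in _ - (X + _)]/B.
set Tp := (X in X + A' - _).
set R1 := (X in _ = X - _ - _).
set R2 := (X in _ = _ - X - _).
set C := (X in _ = _ - _ - X).
move: E; rewrite -/Tp -/R1 -/R2 -/C. lra.
Qed.

Lemma first_variation_le0 :
  (forall i, total_cost u <= total_cost (perturb u du i)) ->
  \sum_(k < N.+1) \int[P]_w hamiltonian_diff k w (0, 0, du k w) <= 0.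
Proof.
move=> opt; rewrite -[leLHS]/(\sum_(k < N.+1) control_term k).
set C := \sum_(k < N.+1) control_term k.
have rem0 : i.+1%:R * \int[P]_w terminal_remainder i w -
    \sum_(k < N.+1) i.+1%:R * \int[P]_w step_remainder i k w @[i --> \oo] -->
    (0 - 0 : R).
  apply: cvgB; last first.
    apply: cvg0_sum => -[k /= kN]; have kN1 := leqW (kN : (k <= N)%N).
    have [D aD dD] := dstate_dominated au adu kN1.
    have [D' [[_ iD'] _ dD']] := dargs_dominated au adu kN aD dD.
    exact: (ham_remainder_cvg0 (F_measurable kN1) (F_measurable (kN : (k.+1 <= N.+1)%N))
      (fun j => increments_measurable j kN) (fun j => increments_square j kN)
      (C1_drift kN) (fun j => C1_diffusion j kN) (C1_running kN) (@adjoint_bd k.+1 kN)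
      (expect_vec P (x k)) (xa kN1) (au kN) iD'
      (fun i => dstate_adapted au adu i kN1) (fun i => aB i kN) dD').
  have [D aD dD] := dstate_dominated au adu (leqnn N.+1).
  have [_ iD] := aD.
  have dT i w : i.+1%:R * `|(terminal_shift i w)| <= D w + \int[P]_w D w.
    have i0 : (0 : R) <= i.+1%:R by [].
    apply: le_trans (ler_wpM2l i0 (norm_triple_le _)) _.
    rewrite /= normr0 addr0 mulrDr lerD//.
    exact: (expect_dstate_le au adu (leqnn N.+1) iD (dD i)).
  have b1 : adapted_bd P (F N.+1) (fun=> 1) by exact: adapted_bd_cst.
  (* The weight 1 puts the terminal remainder in the form of [remainder_cvg0]. *)
  have E i : \int[P]_w terminal_remainder i w = \int[P]_w (1 * terminal_remainder i w).
    by apply: eq_Rintegral => w _; rewrite mul1r.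
  under eq_cvg do rewrite E.
  exact: (@remainder_cvg0 _ _ _ P _ FN _ _ _ (expect_vec P (x N.+1)) _
    (xa (leqnn _)) z0 terminal_fun _ _ (fun i => dstate u du i N.+1)
    (fun i => expect_vec P (dstate u du i N.+1)) (fun=> fun=> 0) C1_terminal b1
    (integrable_rvD iD (integrable_rv_cst P _)) adN (fun=> z0) dT).
rewrite subr0 in rem0.
(* Optimality multiplied by [i + 1] bounds the constant [C] by a sequence tending to 0. *)
have /(_ _)/= : forall i, C <= i.+1%:R * \int[P]_w terminal_remainder i w -
    \sum_(k < N.+1) i.+1%:R * \int[P]_w step_remainder i k w.
  move=> i; have := opt i; rewrite -subr_ge0 cost_variation.
  have i0 : (0 : R) < i.+1%:R by [].
  rewrite -(pmulr_rge0 _ i0) !mulrBr mulrA divff ?gt_eqF// mul1r subr_ge0.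
  by rewrite big_distrr.
move=> HC; rewrite -(cvg_lim _ rem0)//; apply: limr_ge.
  by apply/cvg_ex; eexists; exact: rem0.
exact: nearW.
Qed.

End FirstVariation.

Definition adjoint_q j k : Omega -> 'cV[R]_n :=
  cond_expect_vec P (F k) (fun w => increments k j w *: adjoint k.+1 w).

Let za k w : Z3 := (x k w, expect_vec P (x k), u k w).

Lemma hamiltonian_diffE k w v : hamiltonian_diff k w v =
  dot (cond_expect_vec P (F k) (adjoint k.+1) w) (h *: 'd (drift_at k) (za k w) v) +
  \sum_(j < m) dot (adjoint_q j k w) ('d (diffusion_at k j) (za k w) v) -
  'd (running_at k) (za k w) v.
Proof. by []. Qed.

Let colD (a b : 'cV[R]_n) i : (a + b) i ord0 = a i ord0 + b i ord0.
Proof. by rewrite mxE. Qed.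

Let colN (a : 'cV[R]_n) i : (- a) i ord0 = - a i ord0.
Proof. by rewrite mxE. Qed.

Let colZ c (a : 'cV[R]_n) i : (c *: a) i ord0 = c * a i ord0.
Proof. by rewrite mxE. Qed.

(** An identity at every point, since both sides use the same chosen versions of the conditional
    expectations. It amounts to reading the differential of the Hamiltonian, entry by entry, as
    transposed Jacobians and gradients. *)
Lemma adjoint_equation k w : (k <= N)%N -> adjoint k w =
  (1%:M + h *: (jac_x_along P pb x u (drift pb) k w)^T)
    *m cond_expect_vec P (filtration W k) (adjoint k.+1) w
  + h *: expect_vec P (fun w' =>
      (jac_y_along P pb x u (drift pb) k w')^T *m adjoint k.+1 w')
  + \sum_(j < m) (jac_x_along P pb x u (diffusion pb j) k w)^T *m adjoint_q j k w
  + \sum_(j < m) expect_vec P (fun w' =>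
      (jac_y_along P pb x u (diffusion pb j) k w')^T *m adjoint_q j k w')
  - grad_x_along P pb x u (running_cost pb) k w
  - expect_vec P (grad_y_along P pb x u (running_cost pb) k).
Proof.
move=> kN; have kN1 := leqW kN; rewrite (adjointE kN).
have [_ df _] := C1_drift kN.
have ds j z : differentiable (diffusion_at k j) z by have [_ d _] := C1_diffusion j kN.
have [_ dl _] := C1_running kN.
rewrite mulmxDl mul1mx -scalemxAl.
apply/colP => i; rewrite !(colD, colN, colZ, summxE) !expect_vecE.
have -> : functional_x (hamiltonian_diff k) w i ord0 =
    hamiltonian_diff k w (delta_mx i ord0, 0, 0) by rewrite mxE.
have -> : \int[P]_w' functional_y (hamiltonian_diff k) w' i ord0 =
    \int[P]_w' hamiltonian_diff k w' (0, delta_mx i ord0, 0).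
  by apply: eq_Rintegral => w' _; rewrite mxE.
rewrite (Rintegral_dham (F_measurable kN1) (F_measurable (kN : (k.+1 <= N.+1)%N))
    (fun j => increments_measurable j kN) (fun j => increments_square j kN)
    (C1_drift kN) (fun j => C1_diffusion j kN) (C1_running kN) (@adjoint_bd k.+1 kN)
    (expect_vec P (x k)) (xa kN1) (au kN)).
have fx : dot (cond_expect_vec P (F k) (adjoint k.+1) w)
      ('d (drift_at k) (za k w) (delta_mx i ord0, 0, 0)) =
    ((jac_x_along P pb x u (drift pb) k w)^T
      *m cond_expect_vec P (filtration W k) (adjoint k.+1) w) i ord0.
  exact: esym (jacobian_x_trmul _ _ (df (za k w))).
have sx j : dot (adjoint_q j k w)
      ('d (diffusion_at k j) (za k w) (delta_mx i ord0, 0, 0)) =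
    ((jac_x_along P pb x u (diffusion pb j) k w)^T *m adjoint_q j k w) i ord0.
  exact: esym (jacobian_x_trmul _ _ (ds j (za k w))).
have lx : 'd (running_at k) (za k w) (delta_mx i ord0, 0, 0) =
    grad_x_along P pb x u (running_cost pb) k w i ord0.
  exact: esym (gradient_x i (dl (za k w))).
have fy w' : dot (adjoint k.+1 w')
      ('d (drift_at k) (za k w') (0, delta_mx i ord0, 0)) =
    ((jac_y_along P pb x u (drift pb) k w')^T *m adjoint k.+1 w') i ord0.
  exact: esym (jacobian_y_trmul _ _ (df (za k w'))).
have sy j w' : dot (adjoint_q j k w')
      ('d (diffusion_at k j) (za k w') (0, delta_mx i ord0, 0)) =
    ((jac_y_along P pb x u (diffusion pb j) k w')^T *m adjoint_q j k w') i ord0.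
  exact: esym (jacobian_y_trmul _ _ (ds j (za k w'))).
have ly w' : 'd (running_at k) (za k w') (0, delta_mx i ord0, 0) =
    grad_y_along P pb x u (running_cost pb) k w' i ord0.
  exact: esym (gradient_y i (dl (za k w'))).
have -> : hamiltonian_diff k w (delta_mx i ord0, 0, 0) =
    h * ((jac_x_along P pb x u (drift pb) k w)^T
      *m cond_expect_vec P (filtration W k) (adjoint k.+1) w) i ord0 +
    \sum_(j < m) ((jac_x_along P pb x u (diffusion pb j) k w)^T
      *m adjoint_q j k w) i ord0 -
    grad_x_along P pb x u (running_cost pb) k w i ord0.
  rewrite hamiltonian_diffE dotZr; congr (h * _ + _ - _); first exact: fx.
  - by apply: eq_bigr => j _; exact: sx.
  - exact: lx.
set Iy := (X in _ + X = _).
have -> : Iy = h * \int[P]_w' ((jac_y_along P pb x u (drift pb) k w')^T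
      *m adjoint k.+1 w') i ord0 +
    \sum_(j < m) expect_vec P (fun w' =>
      (jac_y_along P pb x u (diffusion pb j) k w')^T *m adjoint_q j k w') i ord0 -
    \int[P]_w' grad_y_along P pb x u (running_cost pb) k w' i ord0.
  congr (h * _ + _ - _).
  - by apply: eq_Rintegral => w' _; exact: fy.
  - apply: eq_bigr => j _; rewrite expect_vecE.
    by apply: eq_Rintegral => w' _; exact: sy.
  - by apply: eq_Rintegral => w' _; exact: ly.
ring.
Qed.

Lemma adjoint_terminal_equation w : adjoint N.+1 w =
  - gradient (fun x' => terminal_cost pb x' (expect_vec P (x N.+1))) (x N.+1 w)
  - expect_vec P (fun w' =>
      gradient (terminal_cost pb (x N.+1 w')) (expect_vec P (x N.+1))).
Proof.
have [_ dphi _] := C1_terminal.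
have -> : adjoint N.+1 = adjoint_terminal by rewrite /adjoint subnn.
apply/colP => i; rewrite !(colD, colN) !expect_vecE; congr (- _ - _).
  rewrite [LHS]mxE; exact: esym (gradient_x i (dphi (terminal_args w))).
apply: eq_Rintegral => w' _.
rewrite [LHS]mxE; exact: esym (gradient_y i (dphi (terminal_args w'))).
Qed.

Lemma is_derive_hamiltonian k w v : (k <= N)%N ->
  is_derive (u k w) v (hamiltonian P pb W x adjoint adjoint_q k w : _ -> R^o)
    (hamiltonian_diff k w (0, 0, v)).
Proof.
move=> kN.
have [_ df _] := C1_drift kN.
have ds j z : differentiable (diffusion_at k j) z by have [_ d _] := C1_diffusion j kN.
have [_ dl _] := C1_running kN.
have D1 := is_derive_dot_u (h *: cond_expect_vec P (F k) (adjoint k.+1) w) v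
  (df (za k w)).
have D2 j := is_derive_dot_u (adjoint_q j k w) v (ds j (za k w)).
have D3 := is_derive_partial3 v (dl (za k w)).
have D := is_deriveB (is_deriveD D1 (is_derive_sum D2)) D3.
(* The factor [h] sits on the fixed vector while differentiating; this moves it back to the
   drift. *)
have dotZA (a b : 'cV[R]_n) : dot (h *: a) b = dot a (h *: b).
  by rewrite dotC !dotZr dotC.
refine (@is_derive_eq _ _ _ _ _ _ _ _
  (eq_ind _ (fun g => is_derive (u k w) v g _) D _ _) _).
  apply/funext => u'; rewrite /hamiltonian !fctE fct_sumE.
  by congr (_ + _ - _); exact: dotZA.
by congr (_ + _ - _); exact: dotZA.
Qed.

(** The gradient lists derivatives along basis vectors; linearity of the differential recovers the
    direction [v]. *)
Lemma dot_gradient_hamiltonian k w v : (k <= N)%N ->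
  dot (gradient (hamiltonian P pb W x adjoint adjoint_q k w) (u k w)) v =
  hamiltonian_diff k w (0, 0, v).
Proof.
move=> kN; rewrite (@linear_sum_delta _ _ _ (fun v => hamiltonian_diff k w (0, 0, v) : R^o)).
  apply: eq_bigr => i _; rewrite mulrC; congr (_ * _); rewrite mxE.
  by have D := is_derive_hamiltonian w (delta_mx i ord0) kN; rewrite derive_val.
move=> c a b; rewrite -[RHS](hamiltonian_diff_linear k w c (0, 0, a) (0, 0, b)).
by rewrite -control_direction_linear.
Qed.

Lemma adjoint_is_solution : adjoint_solution P pb W x u adjoint adjoint_q.
Proof.
split.
- by move=> k kN i; case: (adjoint_bd kN i).
- move=> j k kN i; have [? _] := q_bd (F_measurable (leqW kN))
    (F_measurable (kN : (k.+1 <= N.+1)%N)) (fun j => increments_measurable j kN)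
    (fun j => increments_square j kN) (@adjoint_bd k.+1 kN) j i.
  by [].
- move=> k kN i.
  by case: (adapted_bd_L1 (F_measurable (kN : (k.+1 <= N.+1)%N)) (@adjoint_bd k.+1 kN i)).
- move=> j k kN i.
  have := increment_adjoint_integrable (F_measurable (leqW kN))
    (F_measurable (kN : (k.+1 <= N.+1)%N)) (fun j => increments_measurable j kN)
    (fun j => increments_square j kN) (@adjoint_bd k.+1 kN) j i.
  by under [X in _ -> integrable_rv _ X]eq_fun do rewrite mxE.
- by move=> k kN; apply: aeW => w; exact: adjoint_equation.
- by apply: aeW => w; exact: adjoint_terminal_equation.
- by move=> j k kN; exact: aeW.
Qed.

End Adjoint.

Lemma cost_total u : admissible_L1 u -> cost P pb W u = (total_cost u)%:E.
Proof.
move=> au; have FN := F_measurable (leqnn N.+1).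
have z0 : adapted_L1_vec P (F N.+1) (fun=> 0 : 'cV[R]_r) by exact: adapted_L1_vec_cst.
have [_ iphi] := adapted_L1_state FN (expect_vec P (state P pb W u N.+1))
  (state_adapted au (leqnn N.+1)) z0 C1_terminal.
have il (k : 'I_N.+1) : integrable_rv P (fun w => running_at k (state_args u k w)).
  have kN : (k <= N)%N by rewrite -ltnS.
  have [_ ?] := adapted_L1_state (F_measurable (leqW kN))
    (expect_vec P (state P pb W u k)) (state_adapted au (leqW kN)) (au k kN)
    (C1_running kN).
  by [].
rewrite /cost unlock /total_cost -(Rintegral_sum _ il) EFinD; congr (_ + _)%E.
- exact: (integral_EFin iphi).
- exact: (integral_EFin (integrable_rv_sum _ il)).
Qed.

Lemma admissible_adapted u : admissible P pb W u -> admissible_L1 u.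
Proof. by move=> uadm k kN; apply: L2_vec_adapted_L1; case: (uadm k kN). Qed.

(** * Needle perturbations and the variational inequality *)

Section Optimality.
Hypothesis A3 : assumption_A3 pb.
Variable u : nat -> Omega -> 'cV[R]_r.
Hypothesis u_admissible : admissible P pb W u.
Hypothesis u_optimal : forall u', admissible P pb W u' ->
  (cost P pb W u <= cost P pb W u')%E.

Let au := admissible_adapted u_admissible.

Section Needle.
Variables (k : nat) (v : 'cV[R]_r) (A : set Omega).
Hypotheses (kN : (k <= N)%N) (Uv : control_set pb (grid pb k) v) (FA : F k A).

Definition needle k' w : 'cV[R]_r :=
  if k' == k then \1_A w *: (v - u k w) else 0.

Let indic_bd : adapted_bd P (F k) (\1_A : Omega -> R).
Proof.
split; last first.
  exists 1; apply: aeW => w; rewrite indicE.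
  by case: (_ \in _); rewrite ?normr1 ?normr0.
apply/measurable_wrtP.
by apply: (@measurable_indic _ (g_sigma_algebraType (filtration_gen W k))).
Qed.

Lemma needle_adapted : admissible_L1 needle.
Proof.
move=> k' k'N; rewrite /needle; case: eqP => [->|_]; last exact: adapted_L1_vec_cst.
move=> i; under eq_fun do rewrite mxE.
apply: (adapted_L1M (F_measurable (leqW kN)) indic_bd).
exact: (adapted_L1_vecB (adapted_L1_vec_cst P _ v) (au kN)).
Qed.

(** On [A], at time [k], the perturbed control is a convex combination of [u] and [v], because eps
    lies between 0 and 1; elsewhere it is [u]. *)
Lemma perturb_needle_admissible i : admissible P pb W (perturb u needle i).
Proof.
have i1 : (i.+1%:R^-1 : R) <= 1 by rewrite invf_le1// ler1n.
have i0 : 0 <= (i.+1%:R^-1 : R) by [].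
move=> k' k'N; have [[mu Lu] Uu] := u_admissible k'N.
have aper := perturb_admissible au needle_adapted i k'N.
split; first split.
- by move=> j; case: (aper j).
- move=> j; apply: (@Lfun2_le _ _ _ P _ (fun w => u k' w j ord0) `|v j ord0|) => //.
    apply: measurable_wrt_measurable_fun (proj1 (aper j)).
    exact: (F_measurable (leqW k'N)).
  move=> w; rewrite /perturb /needle; case: eqP => [->|_].
    rewrite indicE !mxE; case: (_ \in _).
      rewrite mul1r (_ : _ + _ = (1 - i.+1%:R^-1) * u k w j ord0 +
        i.+1%:R^-1 * v j ord0); last by ring.
      rewrite (le_trans (ler_normD _ _))// !normrM lerD//.
        by rewrite ler_piMl// ger0_norm ?subr_ge0// gerBl.
      by rewrite ler_piMl// ger0_norm.
    by rewrite mul0r mulr0 addr0 lerDl.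
  by rewrite scaler0 addr0 lerDl.
- apply: filterS Uu => w Uu; rewrite /perturb /needle.
  case: eqP => [k'k|_]; last by rewrite scaler0 addr0.
  rewrite indicE; case: (_ \in _); last by rewrite scale0r scaler0 addr0.
  rewrite scale1r; subst k'.
  exact: (convex_set_segment i0 i1 (A3 kN) Uu Uv).
Qed.

End Needle.

Let hamiltonian_diff0 k w : hamiltonian_diff u k w (0, 0, 0) = 0.
Proof.
have := hamiltonian_diff_linear u k w (-1) (0, 0, 0) (0, 0, 0).
by rewrite -control_direction_linear scaler0 addr0 scaleN1r addNr.
Qed.

Lemma variational_inequality k v : (k <= N)%N -> control_set pb (grid pb k) v ->
  {ae P, forall w, hamiltonian_diff u k w (0, 0, v - u k w) <= 0}.
Proof.
move=> kN Uv; have GM := F_measurable (leqW kN).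
have aZ := functional_adapted_L1 GM (@hamiltonian_diff_linear u k)
  (fun v' => hamiltonian_diff_bd au v' kN) 0 (adapted_L1_vec_cst P _ 0)
  (adapted_L1_vecB (adapted_L1_vec_cst P _ v) (au kN)).
have [mZ iZ] := aZ.
apply: (ae_le0_sub_sigma GM mZ iZ) => A FA.
have H : \sum_(j < N.+1) \int[P]_w hamiltonian_diff u j w (0, 0, needle k v A j w) <= 0.
  apply: (first_variation_le0 au (needle_adapted v kN FA)) => i.
  rewrite -lee_fin -!cost_total//.
    by apply: u_optimal; exact: perturb_needle_admissible.
  exact: perturb_admissible au (needle_adapted v kN FA) i.
(* Only the term at time [k] survives, as the needle vanishes at the other times. *)
rewrite (bigD1 (Ordinal (kN : (k < N.+1)%N)))//= big1 ?addr0 in H; last first.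
  move=> j jk; rewrite -[RHS](Rintegral_cstT P); apply: eq_Rintegral => w _.
  have jk' : (val j == k) = false by apply/negbTE; rewrite -val_eqE in jk.
  rewrite /needle jk'.
  exact: hamiltonian_diff0.
apply: le_trans H; rewrite le_eqVlt; apply/orP; left; apply/eqP.
(* By linearity the indicator leaves the direction, and the expectation becomes an integral over
   [A]. *)
rewrite -Rintegral_indicM.
apply: eq_Rintegral => w _; rewrite /needle eqxx.
have := hamiltonian_diff_linear u k w (\1_A w) (0, 0, v - u k w) (0, 0, 0).
by rewrite -control_direction_linear addr0 hamiltonian_diff0 addr0.
Qed.

End Optimality.

End Dynamics.

(** * The stochastic maximum principle for the given optimal pair *)

Unset Implicit Arguments.

Theorem theorem2 (disp : measure_display) (Omega : measurableType disp)
  (R : realType) (P : probability Omega R)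
  (n r m : nat) (pb : control_problem R n r m)
  (W : nat -> Omega -> 'cV[R]_m)
  (xhat : nat -> Omega -> 'cV[R]_n) (uhat : nat -> Omega -> 'cV[R]_r)
  (P_complete : measure_is_complete P)
  (N_gt0 : (0 < horizon pb)%N) (h_gt0 : 0 < step pb)
  (W_noise : noise P (step pb) (horizon pb) W)
  (U_nonempty : forall k, (k <= horizon pb)%N ->
     control_set pb (grid pb k) !=set0)
  (opt : optimal_pair P pb W xhat uhat)
  (A1 : assumption_A1 pb) (A2 : assumption_A2 pb)
  (A3 : assumption_A3 pb) (A4 : assumption_A4 P pb xhat)
  (phi_regular : {ae P, forall w,
     let z := (xhat (horizon pb).+1 w, expect_vec P (xhat (horizon pb).+1)) in
     let phi := (fun z' => terminal_cost pb z'.1 z'.2 :> R^o) in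
     (exists2 V, nbhs z V & [lipschitz phi z' | z' in V]) /\
     differentiable phi z}) :
  exists (p : nat -> Omega -> 'cV[R]_n) (q : 'I_m -> nat -> Omega -> 'cV[R]_n),
    adjoint_solution P pb W xhat uhat p q /\
    forall k, (k <= horizon pb)%N ->
    forall v, control_set pb (grid pb k) v ->
      {ae P, forall w,
        dot (gradient (hamiltonian P pb W xhat p q k w) (uhat k w))
            (v - uhat k w) <= 0}.
Proof.
have [uadm xE uopt] := opt.
have h0 : 0 <= step pb by exact: ltW.
have sol := adjoint_is_solution W_noise A1 A2 (admissible_adapted uadm).
exists (adjoint P pb W uhat), (adjoint_q P pb W uhat); split.
  case: sol => s1 s2 s3 s4 s5 s6 s7.
  (* [xhat] is known to coincide with [state] only up to index [N + 1], so the two clauses that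
     mention it are transported separately. *)
  refine (Build_adjoint_solution s1 s2 s3 s4 _ _ s7).
  - move=> k kN; have := s5 k kN.
    by rewrite /jac_x_along /jac_y_along /grad_x_along /grad_y_along (xE k (leqW kN)).
  - by rewrite (xE _ (leqnn _)).
move=> k kN v Uv.
have HE w : hamiltonian P pb W xhat (adjoint P pb W uhat) (adjoint_q P pb W uhat) k w =
  hamiltonian P pb W (state P pb W uhat) (adjoint P pb W uhat) (adjoint_q P pb W uhat) k w.
  by rewrite /hamiltonian (xE k (leqW kN)).
have := variational_inequality W_noise h0 A1 A2 A3 uadm uopt kN Uv.
apply: filterS => w; rewrite HE.
by rewrite (dot_gradient_hamiltonian P W A1 A2 uhat).
Qed.
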